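(* Let $\rho\in(0,1)$, let $M\in\mathbb{R}$ with $|M|<4$, and put $$\zeta:=\frac{4}{4+M-M\rho^2},\qquad \xi:=\frac{4+M}{4+M-M\rho^2}.$$ Let $B(0,r)\subset\mathbb{R}^2$ be the ball of radius $r$ centred at $0$, and define $u:B(0,1)\to\mathbb{R}^2$ by $$u(x)=\begin{cases}\zeta x & x\in B(0,\rho),\\ \left(\xi+\frac{1-\xi}{|x|^2}\right)x & x\in B(0,1)\setminus B(0,\rho).\end{cases}$$ Then $u$ is the unique global minimizer of the Dirichlet energy $\mathbb{D}(v)=\int_{B(0,1)}|\nabla v|^2\,dx$ in the class $$\{v\in H^1_{\mathrm{id}}(B(0,1);\mathbb{R}^2):\ \det\nabla v=g\ \text{a.e.}\},$$ where $g(x):=\zeta^2$ if $x\in B(0,\rho)$ and $g(x):=\xi^2-(1-\xi)^2|x|^{-4}$ if $x\in B(0,1)\setminus B(0,\rho)$.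
   Context: $H^1_{\mathrm{id}}(B(0,1);\mathbb{R}^2)$ is the set of $v\in H^1(B(0,1);\mathbb{R}^2)$ whose trace on $\partial B(0,1)$ is the identity map $x\mapsto x$. $|\cdot|$ is the Frobenius norm on matrices. *)

(* Defs.v *)
From HB Require Import structures.
From mathcomp Require Import all_boot all_order all_algebra.
From mathcomp Require Import all_classical all_reals all_analysis.
Set Implicit Arguments.
Unset Strict Implicit.
Unset Printing Implicit Defensive.
Import Order.TTheory GRing.Theory Num.Theory.
Import numFieldNormedType.Exports.
Local Open Scope classical_set_scope.
Local Open Scope ring_scope.

Definition cpt (R : realType) (x : R * R) (i : 'I_2) : R :=
  if i == 0 then x.1 else x.2.

Definition basis_vec (R : realType) (j : 'I_2) : R * R :=
  ((j == 0)%:R, (j == 1)%:R).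

(* The library norm on [R * R] is the sup norm, and [ball] refers to it. *)
Definition enorm (R : realType) (x : R * R) : R :=
  Num.sqrt (x.1 ^+ 2 + x.2 ^+ 2).

Definition disc (R : realType) (r : R) : set (R * R) := [set x | enorm x < r].

Definition frobenius (R : realType) (A : 'M[R]_2) : R :=
  Num.sqrt (\sum_i \sum_j A i j ^+ 2).

Notation leb2 R := ((@lebesgue_measure R) \x (@lebesgue_measure R))%E.

Definition partial (R : realType) (j : 'I_2) (f : R * R -> R) : R * R -> R :=
  fun x => 'D_(basis_vec R j) f x.

Fixpoint classC (R : realType) (k : nat) (f : R * R -> R) : Prop :=
  if k is k'.+1 then
    continuous f /\
    forall j : 'I_2, (forall x, derivable f x (basis_vec R j)) /\
                     classC k' (partial j f)
  else continuous f.

Definition test_function (R : realType) (D : set (R * R)) (f : R * R -> R) :=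
  [/\ forall k, classC k f,
      compact (closure [set x | f x != 0]) &
      closure [set x | f x != 0] `<=` D].

Definition L2 (R : realType) (D : set (R * R)) (f : R * R -> R) :=
  measurable_fun (D : set (measurableTypeR R * measurableTypeR R)) f /\
  (leb2 R).-integrable D (fun x => (f x ^+ 2)%:E).

Definition weak_partial (R : realType) (D : set (R * R)) (j : 'I_2)
    (f h : R * R -> R) :=
  forall phi, test_function D phi ->
    (\int[leb2 R]_(x in D) (f x * partial j phi x)%:E =
     - \int[leb2 R]_(x in D) (h x * phi x)%:E)%E.

(* An element of H^1(D; R^2) is bundled with its weak gradient, which is unique
   up to null sets; [grad x i j] is the j-th partial derivative of the i-th
   component.  Values outside D are irrelevant. *)
Record H1 (R : realType) (D : set (R * R)) := MkH1 {
  fn :> R * R -> R * R ;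
  grad : R * R -> 'M[R]_2 ;
  fn_L2 : forall i, L2 D (fun x => cpt (fn x) i) ;
  grad_L2 : forall i j, L2 D (fun x => grad x i j) ;
  fn_weak_grad : forall i j,
    weak_partial D j (fun x => cpt (fn x) i) (fun x => grad x i j) }.

Definition jac (R : realType) (f : R * R -> R * R) (x : R * R) : 'M[R]_2 :=
  \matrix_(i, j) partial j (fun y => cpt (f y) i) x.

(* [w] is the trace of [v] on the unit circle.  The trace operator is the
   continuous extension to H^1 of the restriction to the circle of maps that are
   C^1 up to the boundary, so its graph is the closure, in H^1 x L^2(circle), of
   the graph of that restriction.  The circle is parametrized by arc length. *)
Definition has_trace (R : realType) (v : H1 (disc (1 : R)))
    (w : R * R -> R * R) :=
  exists f : nat -> R * R -> R * R,
  [/\ forall k i, classC 1 (fun x => cpt (f k x) i),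
      (fun k => (\int[leb2 R]_(x in disc 1)
         (enorm (f k x - v x) ^+ 2)%:E)%E) @ \oo --> 0%E,
      (fun k => (\int[leb2 R]_(x in disc 1)
         (frobenius (jac (f k) x - grad v x) ^+ 2)%:E)%E) @ \oo --> 0%E &
      (fun k => (\int[@lebesgue_measure R]_(t in `[0%R, (2 * pi)%R])
         (enorm (f k (cos t, sin t) - w (cos t, sin t)) ^+ 2)%:E)%E)
        @ \oo --> 0%E].

Definition H1_id (R : realType) : set (H1 (disc (1 : R))) :=
  [set v | has_trace v id].

Definition dirichlet (R : realType) (v : H1 (disc (1 : R))) : \bar R :=
  (\int[leb2 R]_(x in disc 1) (frobenius (grad v x) ^+ 2)%:E)%E.

Definition admissible (R : realType) (g : R * R -> R) :
    set (H1 (disc (1 : R))) :=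
  [set v | H1_id v /\
    {ae leb2 R, forall x, disc 1 x -> \det (grad v x) = g x}].

Definition global_minimizer (R : realType) (C : set (H1 (disc (1 : R))))
    (v : H1 (disc (1 : R))) :=
  C v /\ forall w, C w -> (dirichlet v <= dirichlet w)%E.

Definition unique_global_minimizer (R : realType)
    (C : set (H1 (disc (1 : R)))) (v : H1 (disc (1 : R))) :=
  global_minimizer C v /\
  forall w, global_minimizer C w ->
    {ae leb2 R, forall x, disc 1 x -> w x = v x}.

Definition zeta (R : realType) (rho M : R) : R :=
  4 / (4 + M - M * rho ^+ 2).

Definition xi (R : realType) (rho M : R) : R :=
  (4 + M) / (4 + M - M * rho ^+ 2).

Definition u (R : realType) (rho M : R) (x : R * R) : R * R :=
  let c := if enorm x < rho then zeta rho M
           else xi rho M + (1 - xi rho M) / enorm x ^+ 2 in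
  (c * x.1, c * x.2).

Definition g (R : realType) (rho M : R) (x : R * R) : R :=
  if enorm x < rho then zeta rho M ^+ 2
  else xi rho M ^+ 2 - (1 - xi rho M) ^+ 2 * enorm x ^- 4.

(* Main.v *)
Require Import Defs.
From mathcomp Require Import all_boot all_order all_algebra.
From mathcomp Require Import all_classical all_reals all_analysis.
From mathcomp Require Import measurable_realfun ring lra.
Import Order.TTheory GRing.Theory Num.Theory.
Import numFieldNormedType.Exports.
Local Open Scope classical_set_scope.
Local Open Scope ring_scope.

(** Let [w] be a competitor of [u], and write its gradient as [G + A] where
    [G = grad u].  Since [det (G + A) = det G], one has [cof G : A = - det A].
    Hence, for every function [s] on the disc,

      |G + A|^2 = |G|^2 + |A|^2 + 2 s det A + 2 (G + s cof G) : A.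

    Take for [s] the step function [weight], equal to [M/4] where [|x| < rho] and
    to [-M/4] elsewhere.  As [2 |det A| <= |A|^2] and [|M|/4 < 1], the quadratic
    part is at least [(1 - |M|/4) |A|^2] ([polyconvex_bound]).  The constants
    [zeta] and [xi] are tuned so that the tensor [G + s cof G] is the cofactor
    matrix of the gradient of a continuous radial map ([stressE]).  The rows of
    such a cofactor matrix are divergence free, also across the circle
    [|x| = rho] where their tangential part jumps, so the tensor is orthogonal to
    the gradients of maps with zero trace, such as [A]
    ([radial_cof_orthogonal]).  The energy of [w] therefore exceeds that of [u] by
    at least [(1 - |M|/4)] times the integral of [|A|^2] ([energy_excess]): [u] is
    a minimizer, and for another minimizer [A = 0], so that [w = u] by the
    Poincare inequality ([zero_trace_poincare]).

    Every integration by parts on the disc rests on one estimate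
    ([green_bound]): for [F] of class C^1, the integral of a partial derivative
    of [F] is at most three times the integral of [|F|] on the circle.  It follows
    from Fubini, the fundamental theorem of calculus on chords, and the
    substitutions [x = cos t] and [y = sin t] on arcs.  An inequality is enough,
    because it is applied to the C^1 maps in the definition of the trace, whose
    boundary values tend to those of the limit in mean square.

    Neither [u] nor the tensor above is of class C^1.  Both are built from
    [1 / max(|x|^2, rho^2)], which is replaced by smooth functions
    ([smooth_profile]) converging to it, boundedly and everywhere, together with
    their first derivatives. *)

Set Implicit Arguments.
Unset Strict Implicit.
Unset Printing Implicit Defensive.

Local Notation plane R := (measurableTypeR R * measurableTypeR R)%type.

(** * Functions on the plane and on the unit disc *)

Lemma ord2P (P : 'I_2 -> Prop) : P 0 -> P 1 -> forall j, P j.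
Proof.
move=> P0 P1 j; have [->//|j1] := eqVneq j 0.
by have -> : j = 1 by case: j j1 => -[|[|//]] //= ? _; exact: val_inj.
Qed.

Lemma cpt0 (R : realType) (z : R * R) : cpt z 0 = z.1. Proof. by []. Qed.
Lemma cpt1 (R : realType) (z : R * R) : cpt z 1 = z.2. Proof. by []. Qed.

Section plane_measure.
Context {R : realType}.

(** The product sigma-algebra is generated by rectangles, and an open set is the
    union of the countably many squares with rational center and radius that it
    contains. *)
Lemma open_measurable_plane (A : set (R * R)) :
  open A -> measurable (A : set (plane R)).
Proof.
move=> oA.
pose box (p : rat * rat * rat) : set (R * R) :=
  ball (ratr p.1.1 : R) (ratr p.2 : R) `*` ball (ratr p.1.2 : R) (ratr p.2 : R).
pose B p : set (plane R) := if `[< box p `<=` A >] then box p else set0.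
have -> : A = \bigcup_p B p.
  apply/seteqP; split => [[x y] Axy|[x y] [p _]]; last first.
    by rewrite /B; case: asboolP => // + ?; apply.
  move: oA; rewrite openE => /(_ _ Axy) /nbhs_ballP[e /= e0 eA].
  have e4 : 0 < e / 4 by rewrite divr_gt0.
  have e42 : e / 4 < e / 2 by lra.
  have [r /[!in_itv]/= /andP[r1 r2]] := rat_in_itvoo e42.
  have [q1] : exists q, ratr q \in `]x - e/4, x + e/4[.
    by apply: rat_in_itvoo; lra.
  rewrite in_itv/= => /andP[q11 q12].
  have [q2] : exists q, ratr q \in `]y - e/4, y + e/4[.
    by apply: rat_in_itvoo; lra.
  rewrite in_itv/= => /andP[q21 q22].
  exists ((q1, q2), r) => //; rewrite /B; case: asboolP => [_|]; last first.
    case=> -[a b] [/=]; rewrite /ball/= => /ltr_normlP[a1 a2] /ltr_normlP[b1 b2].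
    by apply: eA; split; rewrite /ball/=; apply/ltr_normlP; split; lra.
  by split; rewrite /ball/=; apply/ltr_normlP; split; lra.
apply: countable_bigcupT_measurable => // p; rewrite /B; case: asboolP => _ //.
by apply: measurableX; apply: open_measurable; exact: ball_open.
Qed.

Lemma continuous_measurable_plane (f : R * R -> R) :
  continuous f -> measurable_fun [set: plane R] f.
Proof.
move=> cf; apply: (measurability _ (RGenOpens.measurableE R)) => //.
move=> _ [_ [a [b ->] <-]]; rewrite setTI.
apply: open_measurable_plane; apply: open_comp; last exact: interval_open.
by move=> x _; exact: cf.
Qed.

Lemma continuous_fst_plane : continuous (fun z : R * R => z.1).
Proof. by move=> z; exact: cvg_fst. Qed.

Lemma continuous_snd_plane : continuous (fun z : R * R => z.2).
Proof. by move=> z; exact: cvg_snd. Qed.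

Definition sqn (z : R * R) : R := z.1 ^+ 2 + z.2 ^+ 2.

Lemma sqn_ge0 z : 0 <= sqn z.
Proof. by rewrite addr_ge0 ?sqr_ge0. Qed.

Lemma continuous_sqn : continuous sqn.
Proof.
move=> z; rewrite /sqn; under eq_fun do rewrite !expr2; rewrite /continuous_at.
by apply: cvgD; apply: cvgM; (exact: cvg_fst || exact: cvg_snd).
Qed.

Lemma discE (r : R) (z : R * R) : 0 < r -> disc r z <-> sqn z < r ^+ 2.
Proof.
move=> r0; rewrite /disc/= /enorm -/(sqn z).
by rewrite -{1}(ger0_norm (ltW r0)) -sqrtr_sqr ltr_sqrt// exprn_gt0.
Qed.

Lemma disc1E : disc (1 : R) = [set z | sqn z < 1].
Proof.
by apply/seteqP; split => z; rewrite (@discE 1)// expr1n.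
Qed.

Lemma measurable_disc1 : measurable (disc (1 : R) : set (plane R)).
Proof.
rewrite disc1E; apply: open_measurable_plane.
apply: (@open_comp _ _ sqn [set x : R | x < 1]); last exact: open_lt.
by move=> x _; exact: continuous_sqn.
Qed.

Lemma disc1_square : disc (1 : R) `<=` `[-1, 1] `*` `[-1, 1].
Proof.
rewrite disc1E => -[x y]; rewrite /sqn/= => h.
by split; rewrite /= in_itv/=; nra.
Qed.

Lemma disc1_finite : (leb2 R (disc 1) < +oo)%E.
Proof.
apply: (@le_lt_trans _ _ (leb2 R (`[-1, 1] `*` `[-1, 1]))).
  apply: le_measure; rewrite ?inE//.
  - exact: measurable_disc1.
  - by apply: measurableX.
  - exact: disc1_square.
rewrite product_measure1E//= !lebesgue_measure_itv/=.
by case: ifPn => _; rewrite -?EFinB -?EFinM ltry.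
Qed.

(** The square contains both the open disc and the unit circle. *)
Lemma continuous_bounded_square (f : R * R -> R) :
  continuous f -> exists2 M : R, 0 < M &
    forall z, (`[-1, 1] `*` `[-1, 1]) z -> `|f z| <= M.
Proof.
move=> cf.
have /compact_bounded[N [Nr NM]] : compact (f @` (`[-1, 1] `*` `[-1, 1])).
  apply: continuous_compact; first exact: continuous_subspaceT.
  by apply: compact_setX; exact: segment_compact.
exists (`|N| + 1); first by rewrite ltr_wpDl.
move=> z Dz; apply: NM; last by exists z.
by rewrite (le_lt_trans (ler_norm N))// ltrDl.
Qed.

Lemma continuous_bounded_disc (f : R * R -> R) :
  continuous f -> exists2 M : R, 0 < M & forall z, disc 1 z -> `|f z| <= M.
Proof.
move=> /continuous_bounded_square[M M0 fM]; exists M => // z Dz.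
exact/fM/disc1_square.
Qed.

End plane_measure.

(** * Chords and arcs of the unit circle *)

Section arcs.
Context {R : realType}.
Notation mu := (@lebesgue_measure R).

Lemma is_derive_continuous (f df : R -> R) :
  (forall x : R, is_derive x 1 f (df x)) -> continuous f.
Proof.
move=> h x; apply: differentiable_continuous; apply/derivable1_diffP.
by have [] := h x.
Qed.

Lemma is_derive_derive1 (f df : R -> R) :
  (forall x : R, is_derive x 1 f (df x)) -> f^`()%classic = df.
Proof. by move=> h; apply/funext => x; rewrite derive1E; have [] := h x. Qed.

Lemma is_derive_LRcontinuous (f df : R -> R) (a b : R) :
  (forall x : R, is_derive x 1 f (df x)) -> derivable_oo_LRcontinuous f a b.
Proof.
move=> h; have cf := is_derive_continuous h; split.
- by move=> x _; have [] := h x.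
- by apply: cvg_at_right_filter; exact: cf.
- by apply: cvg_at_left_filter; exact: cf.
Qed.

Lemma continuous_measurable_EFin (f : R -> R) (A : set R) :
  continuous f -> measurable_fun A (EFin \o f).
Proof.
move=> cf; apply/measurable_EFinP; apply: measurable_funTS.
exact: continuous_measurable_fun.
Qed.

(** Integration by substitution followed by the bound 1 on the derivative.  The
    derivative may vanish at the end points, as that of [cos] does, hence the passage
    to open intervals. *)
Lemma le_integral_subst_incr (G th dth : R -> R) (a b : R) : a <= b ->
  (forall t : R, is_derive t 1 th (dth t)) -> continuous dth ->
  (forall t, dth t <= 1) -> (forall t, a < t < b -> 0 < dth t) ->
  continuous G -> (forall x, 0 <= G x) ->
  (\int[mu]_(x in `[th a, th b]) (G x)%:E <=
   \int[mu]_(t in `[a, b]) (G (th t))%:E)%E.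
Proof.
move=> ab dth' cdth le1 gt0 cG G0.
have cth := is_derive_continuous dth'.
have dE := is_derive_derive1 dth'.
have cGth : continuous (G \o th).
  by move=> t; apply: continuous_comp; [exact: cth|exact: cG].
have cP : continuous ((G \o th) * dth).
  by move=> t; apply: cvgM; [exact: cGth|exact: cdth].
rewrite (@integration_by_substitution_increasing _ th)//; last 6 first.
- apply: gtr0_derive1_lt_cc.
  + by move=> x _; have [] := dth' x.
  + by move=> x; rewrite in_itv/= dE => /gt0.
  + exact: continuous_subspaceT.
- by rewrite dE => x _; exact: cdth.
- rewrite dE; apply: cvgP; apply: cvg_at_right_filter; exact: cdth.
- rewrite dE; apply: cvgP; apply: cvg_at_left_filter; exact: cdth.
- exact: is_derive_LRcontinuous dth'.
- exact: continuous_subspaceT.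
rewrite dE !(@integral_itv_bndoo _ _ _ _ true false); [|exact: continuous_measurable_EFin..].
apply: ge0_le_integral => //.
- move=> x /=; rewrite in_itv/= => /gt0/ltW d0.
  by rewrite lee_fin; exact: (mulr_ge0 (G0 _) d0).
- exact: continuous_measurable_EFin.
- exact: continuous_measurable_EFin.
- move=> x _; rewrite lee_fin /=.
  by have := ler_wpM2l (G0 (th x)) (le1 x); rewrite mulr1.
Qed.

Lemma le_integral_subst_decr (G th dth : R -> R) (a b : R) : a <= b ->
  (forall t : R, is_derive t 1 th (dth t)) -> continuous dth ->
  (forall t, -1 <= dth t) -> (forall t, a < t < b -> dth t < 0) ->
  continuous G -> (forall x, 0 <= G x) ->
  (\int[mu]_(x in `[th b, th a]) (G x)%:E <=
   \int[mu]_(t in `[a, b]) (G (th t))%:E)%E.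
Proof.
move=> ab dth' cdth geN1 lt0 cG G0.
have cth := is_derive_continuous dth'.
have dE := is_derive_derive1 dth'.
have cGth : continuous (G \o th).
  by move=> t; apply: continuous_comp; [exact: cth|exact: cG].
have cP : continuous ((G \o th) * - dth).
  by move=> t; apply: cvgM; [exact: cGth|apply: cvgN; exact: cdth].
rewrite (@integration_by_substitution_decreasing _ th)//; last 6 first.
- apply: ltr0_derive1_lt_cc.
  + by move=> x _; have [] := dth' x.
  + by move=> x; rewrite in_itv/= dE => /lt0.
  + exact: continuous_subspaceT.
- by rewrite dE => x _; exact: cdth.
- rewrite dE; apply: cvgP; apply: cvg_at_right_filter; exact: cdth.
- rewrite dE; apply: cvgP; apply: cvg_at_left_filter; exact: cdth.
- exact: is_derive_LRcontinuous dth'.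
- exact: continuous_subspaceT.
rewrite dE !(@integral_itv_bndoo _ _ _ _ true false); [|exact: continuous_measurable_EFin..].
apply: ge0_le_integral => //.
- move=> x /=; rewrite in_itv/= => /lt0/ltW d0.
  by rewrite lee_fin; apply: (mulr_ge0 (G0 _)); rewrite oppr_ge0.
- exact: continuous_measurable_EFin.
- exact: continuous_measurable_EFin.
- move=> x _; rewrite lee_fin /=.
  have N1 : - dth x <= 1 by rewrite lerNl.
  by have := ler_wpM2l (G0 (th x)) N1; rewrite mulr1.
Qed.

Definition circle_int (F : R * R -> R) : \bar R :=
  (\int[mu]_(t in `[0%R, (2 * pi)%R]) `|F (cos t, sin t)|%:E)%E.

Lemma continuous_along (F : R * R -> R) (f g : R -> R) :
  continuous F -> continuous f -> continuous g ->
  continuous (fun t => F (f t, g t)).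
Proof.
move=> cF cf cg t.
apply: (@continuous_comp _ _ _ (fun t => (f t, g t)) F); last exact: cF.
exact: (cvg_pair (cf t) (cg t)).
Qed.

Variable F : R * R -> R.
Hypothesis cF : continuous F.

Lemma continuous_pair (f g : R -> R) : continuous f -> continuous g ->
  continuous (fun t => `|F (f t, g t)|).
Proof.
move=> cf cg t.
apply: (@continuous_comp _ _ _ (fun t => F (f t, g t)) Num.norm).
  exact: continuous_along.
exact: norm_continuous.
Qed.

Definition chord (y : R) : R := Num.sqrt (1 - y ^+ 2).

Lemma continuous_chord : continuous chord.
Proof.
move=> y; apply: (@continuous_comp _ _ _ (fun y : R => 1 - y ^+ 2) Num.sqrt).
  by apply: cvgB; [exact: cvg_cst|exact: exprn_continuous].
exact: sqrt_continuous.
Qed.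

Lemma continuous_chordN : continuous (fun y => - chord y).
Proof. by move=> y; apply: cvgN; exact: continuous_chord. Qed.

Lemma continuous_compR (g f : R -> R) :
  continuous g -> continuous f -> continuous (fun t => g (f t)).
Proof. by move=> cg cf t; apply: continuous_comp; [exact: cf|exact: cg]. Qed.

Lemma continuous_cstR (c : R) : continuous (fun _ : R => c).
Proof. exact: cst_continuous. Qed.

Lemma continuous_idR : continuous (fun y : R => y).
Proof. by move=> y; exact: cvg_id. Qed.

(** Each arc is compared with the whole circle: overlaps only cost a constant. *)
Lemma circle_int_sub (a b : R) (H : R -> R) : 0 <= a -> b <= 2 * pi ->
  {in `]a, b[, forall t, H t = `|F (cos t, sin t)|} ->
  continuous H ->
  (\int[mu]_(t in `[a, b]) (H t)%:E <= circle_int F)%E.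
Proof.
move=> a0 b2 HE cH.
have cF' := continuous_pair (@continuous_cos R) (@continuous_sin R).
have mF := continuous_measurable_EFin (A := `[0, 2 * pi]) cF'.
rewrite (@integral_itv_bndoo _ _ _ _ true false); last exact: continuous_measurable_EFin.
under eq_integral => t tab.
  rewrite HE; last by move: tab; rewrite inE.
  over.
apply: ge0_subset_integral => //.
  move=> x /=; rewrite !in_itv/= => /andP[ax xb].
  by rewrite (le_trans a0 (ltW ax)) (le_trans (ltW xb) b2).
Qed.

Lemma chord_cos (t : R) : chord (cos t) = `|sin t|.
Proof. by rewrite /chord -sin2cos2 sqrtr_sqr. Qed.

Lemma chord_sin (t : R) : chord (sin t) = `|cos t|.
Proof. by rewrite /chord -cos2sin2 sqrtr_sqr. Qed.

Lemma sin_lt0_pi2pi (t : R) : pi < t < 2 * pi -> sin t < 0.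
Proof.
move=> /andP[t1 t2]; rewrite -(subrK pi t) sinDpi oppr_lt0.
by apply: sin_gt0_pi; lra.
Qed.

Lemma cos_lt0_pihalf (t : R) : pi / 2 < t < 3 * pi / 2 -> cos t < 0.
Proof.
move=> /andP[t1 t2]; rewrite -(subrK pi t) cosDpi oppr_lt0.
by apply: cos_gt0_pihalf; lra.
Qed.

Lemma cos_gt0_3pihalf (t : R) : 3 * pi / 2 < t < 2 * pi -> 0 < cos t.
Proof.
move=> /andP[t1 t2]; rewrite -(subrK (pi *+ 2) t) cosD2pi.
by apply: cos_gt0_pihalf; rewrite (mulr2n pi); have p0 := pi_gt0 R; lra.
Qed.

Lemma sin_3pihalf : sin (3 * pi / 2) = -1 :> R.
Proof.
rewrite (_ : 3 * pi / 2 = pi / 2 + pi); last by lra.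
by rewrite sinDpi sin_pihalf.
Qed.

Lemma sin_2pi : sin (2 * pi) = 0 :> R.
Proof. by rewrite mulr_natl sin2pi. Qed.

Lemma cos_2pi : cos (2 * pi) = 1 :> R.
Proof. by rewrite mulr_natl cos2pi. Qed.

Lemma continuous_Nsin : continuous (fun t : R => - sin t).
Proof. by move=> t; apply: cvgN; exact: continuous_sin. Qed.

Lemma le_Nsin (t : R) : - sin t <= 1.
Proof. by rewrite lerNl sin_geN1. Qed.

Lemma ge_Nsin (t : R) : -1 <= - sin t.
Proof. by rewrite lerN2 sin_le1. Qed.

Lemma upper_half :
  (\int[mu]_(x in `[(-1)%R, 1%R]) `|F (x, chord x)|%:E <= circle_int F)%E.
Proof.
have cG := continuous_pair continuous_idR continuous_chord.
have cH := continuous_pair (@continuous_cos R)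
  (continuous_compR continuous_chord (@continuous_cos R)).
have := le_integral_subst_decr (ltW (pi_gt0 R)) (@is_derive_cos R) continuous_Nsin
  ge_Nsin _ cG (fun=> normr_ge0 _).
rewrite cospi cos0 => /(_ _)/le_trans; apply.
  by move=> t t0; rewrite oppr_lt0; exact: sin_gt0_pi.
apply: circle_int_sub => //; first by have p0 := pi_gt0 R; lra.
move=> t; rewrite in_itv/= => t0.
by rewrite chord_cos (gtr0_norm (sin_gt0_pi t0)).
Qed.

Lemma lower_half :
  (\int[mu]_(x in `[(-1)%R, 1%R]) `|F (x, - chord x)|%:E <= circle_int F)%E.
Proof.
have cG := continuous_pair continuous_idR continuous_chordN.
have cH := continuous_pair (@continuous_cos R)
  (continuous_compR continuous_chordN (@continuous_cos R)).
have p2 : pi <= 2 * pi :> R by have p0 := pi_gt0 R; lra.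
have := le_integral_subst_incr p2 (@is_derive_cos R) continuous_Nsin
  le_Nsin _ cG (fun=> normr_ge0 _).
rewrite cospi cos_2pi => /(_ _)/le_trans; apply.
  by move=> t t0; rewrite oppr_gt0; exact: sin_lt0_pi2pi.
apply: circle_int_sub => //; first by have p0 := pi_gt0 R; lra.
move=> t; rewrite in_itv/= => t0.
by rewrite chord_cos (ltr0_norm (sin_lt0_pi2pi t0)) ?opprK.
Qed.

Lemma left_half :
  (\int[mu]_(y in `[(-1)%R, 1%R]) `|F (- chord y, y)|%:E <= circle_int F)%E.
Proof.
have cG := continuous_pair continuous_chordN continuous_idR.
have cH := continuous_pair
  (continuous_compR continuous_chordN (@continuous_sin R))
  (@continuous_sin R).
have p2 : pi / 2 <= 3 * pi / 2 :> R by have p0 := pi_gt0 R; lra.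
have := le_integral_subst_decr p2 (@is_derive_sin R) (@continuous_cos R)
  (@cos_geN1 R) _ cG (fun=> normr_ge0 _).
rewrite sin_3pihalf sin_pihalf => /(_ _)/le_trans; apply.
  by move=> t t0; exact: cos_lt0_pihalf.
apply: circle_int_sub => //; [by have p0 := pi_gt0 R; lra|by have p0 := pi_gt0 R; lra|].
move=> t; rewrite in_itv/= => t0.
by rewrite chord_sin (ltr0_norm (cos_lt0_pihalf t0)) ?opprK.
Qed.

(** The right half of the circle contains the parameter 0, where the interval
    from 0 to [2 * pi] is cut: the chords below and above the horizontal axis are
    treated separately, and each half arc is bounded by the whole circle. *)
Lemma right_half :
  (\int[mu]_(y in `[(-1)%R, 1%R]) `|F (chord y, y)|%:E <=
   circle_int F + circle_int F)%E.
Proof.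
have cG := continuous_pair continuous_chord continuous_idR.
have cH := continuous_pair
  (continuous_compR continuous_chord (@continuous_sin R))
  (@continuous_sin R).
rewrite (@itv_bndbnd_setU _ R _ (BLeft (0:R)) (BRight (1:R))) ?bnd_simp//.
rewrite ge0_integral_setU//=; last 2 first.
  exact: continuous_measurable_EFin.
  apply/disj_setPS => x/=; rewrite !in_itv/= => -[/andP[_ +] /andP[+ _]].
  by move=> /lt_le_trans/[apply]; rewrite ltxx.
rewrite integral_itv_bndo_bndc; last exact: continuous_measurable_EFin.
apply: leeD.
- have p2 : 3 * pi / 2 <= 2 * pi :> R by have p0 := pi_gt0 R; lra.
  have := le_integral_subst_incr p2 (@is_derive_sin R) (@continuous_cos R)
    (@cos_le1 R) cos_gt0_3pihalf cG (fun=> normr_ge0 _).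
  rewrite sin_3pihalf sin_2pi => /le_trans; apply.
  apply: circle_int_sub => //; first by have p0 := pi_gt0 R; lra.
  move=> t; rewrite in_itv/= => t0.
  by rewrite chord_sin (gtr0_norm (cos_gt0_3pihalf t0)).
- have p2 : 0 <= pi / 2 :> R by have p0 := pi_gt0 R; lra.
  have := le_integral_subst_incr p2 (@is_derive_sin R) (@continuous_cos R)
    (@cos_le1 R) _ cG (fun=> normr_ge0 _).
  rewrite sin0 sin_pihalf => /(_ _)/le_trans; apply.
    by move=> t t0; apply: cos_gt0_pihalf; have p0 := pi_gt0 R; lra.
  apply: circle_int_sub => //; first by have p0 := pi_gt0 R; lra.
  move=> t; rewrite in_itv/= => t0.
  have c0 : 0 < cos t by apply: cos_gt0_pihalf; have p0 := pi_gt0 R; lra.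
  by rewrite chord_sin (gtr0_norm c0).
Qed.

End arcs.

(** * Integration of partial derivatives on the disc *)

Section green.
Context {R : realType}.
Notation mu := (@lebesgue_measure R).

(** A directional derivative only depends on the values along a line; this
    reduces partial derivatives to derivatives of functions of one variable. *)
Lemma is_derive_congr (V1 V2 : normedModType R) (f1 : V1 -> R) (f2 : V2 -> R)
    (a1 v1 : V1) (a2 v2 : V2) (d : R) :
  (forall h : R, f1 (h *: v1 + a1) = f2 (h *: v2 + a2)) ->
  is_derive a1 v1 f1 d -> is_derive a2 v2 f2 d.
Proof.
move=> E [].
have E0 : f1 a1 = f2 a2 by have := E 0; rewrite !scale0r !add0r.
rewrite /derivable /derive; set g1 := (fun h => h^-1 *: _) => c1 l1.
split; rewrite /derivable /derive; set g2 := (fun h => h^-1 *: _);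
  (suff -> : g2 = g1 by []);
  by apply/funext => h; rewrite /g1 /g2 /= E E0.
Qed.

Lemma is_derive_slice1 (F : R * R -> R) (x y d : R) :
  is_derive (x, y) (basis_vec R 0) F d <-> is_derive x 1 (fun t => F (t, y)) d.
Proof.
have E (h : R) : h *: basis_vec R 0 + (x, y) = (h + x, y).
  by congr pair; rewrite /= /GRing.scale/= ?mulr1// mulr0 add0r.
by split; apply: is_derive_congr => h; rewrite E [h *: 1]mulr1.
Qed.

Lemma is_derive_slice2 (F : R * R -> R) (x y d : R) :
  is_derive (x, y) (basis_vec R 1) F d <-> is_derive y 1 (fun t => F (x, t)) d.
Proof.
have E (h : R) : h *: basis_vec R 1 + (x, y) = (x, h + y).
  by congr pair; rewrite /= /GRing.scale/= ?mulr1// mulr0 add0r.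
by split; apply: is_derive_congr => h; rewrite E [h *: 1]mulr1.
Qed.

Lemma integral_derive (f df : R -> R) (a : R) : 0 <= a ->
  (forall x : R, is_derive x 1 f (df x)) -> continuous df ->
  (\int[mu]_(x in `](- a)%R, a[) (df x)%:E = (f a - f (- a))%:E)%E.
Proof.
rewrite le_eqVlt => /predU1P[<- _ _|a0 dfE cdf].
  by rewrite oppr0 set_itvoo0 integral_set0 subrr.
rewrite -(@integral_itv_bndoo _ _ _ _ true false); last first.
  exact: continuous_measurable_EFin.
rewrite (@continuous_FTC2 _ df f); first by rewrite EFinB.
- by lra.
- exact: continuous_subspaceT.
- exact: is_derive_LRcontinuous dfE.
- by move=> x _; rewrite (is_derive_derive1 dfE).
Qed.

(** For [1 <= |y|] the slice is empty and [chord y = 0], so that both sides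
    vanish. *)
Lemma integral_slice (f df : R -> R) (y : R) :
  (forall x : R, is_derive x 1 f (df x)) -> continuous df ->
  (\int[mu]_(x in [set x | (sqn (x, y) < 1)%R]) (df x)%:E =
   (f (chord y) - f (- chord y))%:E)%E.
Proof.
move=> dfE cdf; rewrite -(@integral_derive _ df)//; last exact: sqrtr_ge0.
congr (integral _ _ _); apply/seteqP; split => x /=.
  rewrite /sqn/= => h; rewrite in_itv/= -ltr_norml /chord -sqrtr_sqr.
  by rewrite ltr_sqrt; nra.
rewrite in_itv/= -ltr_norml /chord -sqrtr_sqr /sqn/= => h.
have : 0 < 1 - y ^+ 2.
  by rewrite -sqrtr_gt0; apply: le_lt_trans h; exact: sqrtr_ge0.
by move=> y0; move: h; rewrite ltr_sqrt//; lra.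
Qed.

Lemma chord0 (y : R) : ~~ (y \in `[(-1), 1]%R) -> chord y = 0.
Proof.
rewrite in_itv/= => h; apply/eqP; rewrite sqrtr_eq0.
by move: h; rewrite negb_and -!ltNge => /orP[]?; nra.
Qed.

Lemma integral_chords (f g : R -> R) :
  continuous f -> continuous g ->
  (forall y, ~~ (y \in `[(-1), 1]%R) -> f y = g y) ->
  (`| \int[mu]_y (f y - g y)%:E | <=
   \int[mu]_(y in `[(-1)%R, 1%R]) `|f y|%:E +
   \int[mu]_(y in `[(-1)%R, 1%R]) `|g y|%:E)%E.
Proof.
move=> cf cg fg.
have c : continuous (fun y => f y - g y).
  by move=> y; apply: cvgB; [exact: cf|exact: cg].
have c1 : continuous (fun y => `|f y|).
  exact: (continuous_compR (@norm_continuous _ R) cf).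
have c2 : continuous (fun y => `|g y|).
  exact: (continuous_compR (@norm_continuous _ R) cg).
have c3 : continuous (fun y => `|f y - g y|).
  exact: (continuous_compR (@norm_continuous _ R) c).
have -> : (\int[mu]_y (f y - g y)%:E)%E =
    (\int[mu]_(y in `[(-1)%R, 1%R]) (f y - g y)%:E)%E.
  rewrite [RHS]integral_mkcond; apply: eq_integral => y _.
  rewrite patchE; case: ifPn => //= h; rewrite fg ?subrr//.
  by move: h; rewrite notin_setE /= => /negP.
apply: (le_trans (le_abse_integral _ _ _)) => //.
  exact: continuous_measurable_EFin.
rewrite -ge0_integralD//=; [|exact: continuous_measurable_EFin..].
apply: ge0_le_integral => //=; [exact: continuous_measurable_EFin| |].
- by apply: emeasurable_funD; exact: continuous_measurable_EFin.
- by move=> x _; rewrite lee_fin ler_normB.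
Qed.

Lemma integrable_continuous_disc (f : R * R -> R) :
  continuous f -> (leb2 R).-integrable (disc 1) (EFin \o f).
Proof.
move=> cf; have [M M0 fM] := continuous_bounded_disc cf.
apply: (@measurable_bounded_integrable _ (plane R)).
- exact: measurable_disc1.
- exact: disc1_finite.
- by apply: measurable_funTS; exact: continuous_measurable_plane.
- exists M; split; first exact: num_real.
  by move=> N MN z Dz /=; apply: le_trans (ltW MN); exact: fM.
Qed.

(** Fubini reduces the integral to differences of values of [F] at the two ends
    of the chords, that is on two half circles.  Each half circle is bounded by one
    full circle, except for the right one, which takes two: hence the constant 3. *)
Lemma green_bound (F dF : R * R -> R) (j : 'I_2) :
  continuous F -> (forall z, is_derive z (basis_vec R j) F (dF z)) ->
  continuous dF ->
  (`| \int[leb2 R]_(z in disc 1) (dF z)%:E | <=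
   circle_int F + circle_int F + circle_int F)%E.
Proof.
move=> cF dFE cdF.
have iF := integrable_continuous_disc cdF.
rewrite integral_mkcond.
have {}iF := (integrable_mkcond _ measurable_disc1).1 iF.
move: j dFE; apply: ord2P => dFE.
  have E y : fubini_G mu ((fun z => (dF z)%:E) \_ (disc 1)) y =
      (F (chord y, y) - F (- chord y, y))%:E.
    have dFy (x : R) : is_derive x 1 (fun x => F (x, y)) (dF (x, y)).
      exact/is_derive_slice1.
    have cdFy := continuous_along cdF continuous_idR (@continuous_cstR R y).
    rewrite -(integral_slice y dFy cdFy).
    rewrite [RHS]integral_mkcond /fubini_G; apply: eq_integral => x _.
    by rewrite !patchE disc1E; congr (if _ then _ else _); apply/idP/idP; rewrite !inE.
  have -> : (\int[leb2 R]_z ((EFin \o dF) \_ (disc 1)) z =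
      \int[mu]_y (F (chord y, y) - F (- chord y, y))%:E)%E.
    by rewrite -(integral21_prod_meas1 iF); apply: eq_integral => y _; exact: E.
  have c1 : continuous (fun y => F (chord y, y)).
    exact: (continuous_along cF continuous_chord continuous_idR).
  have c2 : continuous (fun y => F (- chord y, y)).
    exact: (continuous_along cF continuous_chordN continuous_idR).
  apply: (le_trans (integral_chords c1 c2 _)).
    by move=> y /chord0 ->; rewrite oppr0.
  by apply: leeD; [exact: (right_half cF)|exact: (left_half cF)].
have E x : fubini_F mu ((fun z => (dF z)%:E) \_ (disc 1)) x =
    (F (x, chord x) - F (x, - chord x))%:E.
  have dFx (y : R) : is_derive y 1 (fun y => F (x, y)) (dF (x, y)).
    exact/is_derive_slice2.
  have cdFx := continuous_along cdF (@continuous_cstR R x) continuous_idR.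
  rewrite -(integral_slice x dFx cdFx).
  rewrite [RHS]integral_mkcond /fubini_F; apply: eq_integral => y _.
  rewrite !patchE disc1E; congr (if _ then _ else _); apply/idP/idP; rewrite !inE/=.
    by rewrite /sqn/= addrC.
  by rewrite /sqn/= addrC.
have -> : (\int[leb2 R]_z ((EFin \o dF) \_ (disc 1)) z =
    \int[mu]_x (F (x, chord x) - F (x, - chord x))%:E)%E.
  by rewrite -(integral12_prod_meas1 iF); apply: eq_integral => x _; exact: E.
have c1 : continuous (fun x => F (x, chord x)).
  exact: (continuous_along cF continuous_idR continuous_chord).
have c2 : continuous (fun x => F (x, - chord x)).
  exact: (continuous_along cF continuous_idR continuous_chordN).
apply: (le_trans (integral_chords c1 c2 _)).
  by move=> y /chord0 ->; rewrite oppr0.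
apply: leeD; last exact: (lower_half cF).
apply: (le_trans (upper_half cF)).
by rewrite leeDl// integral_ge0.
Qed.

End green.

(** * Convergence in mean and in mean square *)

Section null_sequences.
Context {R : realType}.

Lemma cvg0_scale (v : nat -> R) (c : R) : v @ \oo --> (0 : R) ->
  (fun k => c * v k) @ \oo --> (0 : R).
Proof.
by move=> v0; rewrite -[X in _ --> X](mulr0 c); apply: cvgM => //; exact: cvg_cst.
Qed.

Lemma cvg0_add (v w : nat -> R) : v @ \oo --> (0 : R) -> w @ \oo --> (0 : R) ->
  (fun k => v k + w k) @ \oo --> (0 : R).
Proof. by move=> v0 w0; rewrite -[X in _ --> X](addr0 0); exact: cvgD. Qed.

Lemma cvg0_squeeze (v w : nat -> R) : (forall k, 0 <= v k <= w k) ->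
  w @ \oo --> (0 : R) -> v @ \oo --> (0 : R).
Proof.
move=> vw w0; apply: (@squeeze_cvgr _ _ _ _ (fun=> 0) w) => //.
  exact: nearW.
exact: cvg_cst.
Qed.

Lemma cvg0_le (u : nat -> R) (c : R) : (forall k, c <= u k) ->
  u @ \oo --> (0 : R) -> c <= 0.
Proof.
move=> cu u0; have := cvg_lim (@Rhausdorff R) u0 => <-.
by apply: limr_ge; [apply: cvgP u0|exact: nearW].
Qed.

Lemma cvg_continuous (g : R -> R) (u : nat -> R) (a : R) : continuous g ->
  u @ \oo --> a -> (fun n => g (u n)) @ \oo --> g a.
Proof. by move=> cg; apply: continuous_cvg; exact: cg. Qed.

End null_sequences.

Section L1_L2.
Context d (T : measurableType d) {R : realType}.
Variables (mu : {measure set T -> \bar R}) (D : set T).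
Hypotheses (mD : measurable D) (muD : (mu D < +oo)%E).
Implicit Types f g : T -> R.

Local Notation itg f := (mu.-integrable D (EFin \o f)).

Lemma itgD f g : itg f -> itg g -> itg (fun x => f x + g x).
Proof. by move=> fi gi; have := integrableD mD fi gi. Qed.

Lemma itgB f g : itg f -> itg g -> itg (fun x => f x - g x).
Proof. by move=> fi gi; have := integrableB mD fi gi. Qed.

Lemma itgZ (k : R) f : itg f -> itg (fun x => k * f x).
Proof. by move=> fi; have := integrableZl mD k fi. Qed.

Lemma itg_norm f : itg f -> itg (fun x => `|f x|).
Proof. by move=> fi; have := integrable_norm fi. Qed.

Lemma itg_cst (k : R) : itg (fun=> k).
Proof.
apply: measurable_bounded_integrable => //.
by exists `|k|; split; [exact: num_real|move=> N /ltW kN x _].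
Qed.

Lemma itg_le f g : measurable_fun D f -> (forall x, D x -> `|f x| <= g x) ->
  itg g -> itg f.
Proof.
move=> mf fg; apply: le_integrable => //; first exact/measurable_EFinP.
by move=> x Dx; rewrite /= lee_fin (le_trans (fg x Dx))// ler_norm.
Qed.

Lemma itg_measurable f : itg f -> measurable_fun D f.
Proof. by move=> /measurable_int/measurable_EFinP. Qed.

Lemma EFin_Rintegral f : itg f ->
  (\int[mu]_(x in D) f x)%:E = (\int[mu]_(x in D) (f x)%:E)%E.
Proof. by move=> fi; rewrite /Rintegral fineK//; exact: integrable_fin_num. Qed.

(** This is the predicate [L2], for any measure: it is also used on the circle. *)
Definition sqitg f := measurable_fun D f /\ itg (fun x => f x ^+ 2).

Lemma sqitg_mul f g : sqitg f -> sqitg g -> itg (fun x => f x * g x).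
Proof.
move=> [mf fi] [mg gi]; apply: itg_le (itgD fi gi).
  exact: measurable_funM.
by move=> x _; rewrite ler_norml; apply/andP; split; nra.
Qed.

Lemma sqitg_bounded f (M : R) : measurable_fun D f ->
  (forall x, D x -> `|f x| <= M) -> sqitg f.
Proof.
move=> mf fM; split => //; apply: itg_le (itg_cst (M ^+ 2)).
  exact: measurable_funX.
move=> x Dx; rewrite ger0_norm ?sqr_ge0// -(real_normK (num_real (f x))).
by rewrite lerXn2r ?nnegrE ?fM// (le_trans _ (fM x Dx)).
Qed.

Lemma sqitg_itg f : sqitg f -> itg f.
Proof.
move=> fi.
have c1 : sqitg (fun=> 1) by apply: (@sqitg_bounded _ 1) => // x _; rewrite normr1.
have := sqitg_mul fi c1; apply: eq_integrable => // x _ /=.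
by rewrite mulr1.
Qed.

Lemma sqitgB f g : sqitg f -> sqitg g -> sqitg (fun x => f x - g x).
Proof.
move=> [mf fi] [mg gi]; split; first exact: measurable_funB.
apply: itg_le (itgD (itgZ 2 fi) (itgZ 2 gi)).
  by apply: measurable_funX; exact: measurable_funB.
move=> x _; rewrite ger0_norm ?sqr_ge0//.
by have := sqr_ge0 (f x + g x); rewrite !expr2; lra.
Qed.

(** [|f| <= dl/2 + f^2/(2 dl)] for every positive [dl]; on a set of finite
    measure the first term is as small as wanted. *)
Lemma cvg_L1_of_L2 (f : nat -> T -> R) : (forall k, sqitg (f k)) ->
  (fun k => \int[mu]_(x in D) (f k x ^+ 2)) @ \oo --> (0 : R) ->
  (fun k => \int[mu]_(x in D) `|f k x|) @ \oo --> (0 : R).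
Proof.
move=> fi f0; apply/cvgr0Pnorm_lt => e e0.
pose m := fine (mu D).
have m0 : 0 <= m by exact: fine_ge0.
have d0 : 0 < e / (m + 1) by rewrite divr_gt0// ltr_wpDl.
set dl := e / (m + 1) in d0 *.
have dlm : dl * (m + 1) = e by rewrite /dl divfK// gt_eqF// ltr_wpDl.
have de0 : 0 < dl * dl by rewrite mulr_gt0.
move/cvgr0Pnorm_lt : f0 => /(_ _ de0); apply: filterS => k.
have I0 : 0 <= \int[mu]_(x in D) (f k x ^+ 2).
  by apply: Rintegral_ge0 => x _; exact: sqr_ge0.
have J0 : 0 <= \int[mu]_(x in D) `|f k x| by exact: Rintegral_ge0.
rewrite (ger0_norm I0) (ger0_norm J0) {J0}.
move: I0; set I := \int[mu]_(x in D) (f k x ^+ 2) => I0 Ie.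
have h : \int[mu]_(x in D) `|f k x| <=
    \int[mu]_(x in D) (dl / 2 + (2 * dl)^-1 * f k x ^+ 2).
  apply: le_Rintegral => //.
  - exact: itg_norm (sqitg_itg (fi k)).
  - apply: itgD; first exact: itg_cst.
    by apply: itgZ; have [] := fi k.
  - move=> x _.
    have : 0 <= (2 * dl)^-1 * (`|f k x| - dl) ^+ 2.
      by rewrite mulr_ge0 ?sqr_ge0// invr_ge0 mulr_ge0// ltW.
    rewrite sqrrB real_normK ?num_real//.
    have -> : (2 * dl)^-1 * (f k x ^+ 2 - `|f k x| * dl *+ 2 + dl ^+ 2) =
        dl / 2 + (2 * dl)^-1 * f k x ^+ 2 - `|f k x|.
      by field; rewrite gt_eqF.
    by rewrite subr_ge0.
apply: le_lt_trans h _.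
rewrite RintegralD//; [|exact: itg_cst|by apply: itgZ; have [] := fi k].
rewrite Rintegral_cst// RintegralZl//; last by have [] := fi k.
rewrite -/I -/m.
have : (2 * dl)^-1 * I < (2 * dl)^-1 * (dl * dl).
  by rewrite ltr_pM2l// invr_gt0 mulr_gt0.
have -> : (2 * dl)^-1 * (dl * dl) = dl / 2 by field; rewrite gt_eqF.
by nra.
Qed.

End L1_L2.

Lemma Rintegral_sqB d (T : measurableType d) (R : realType)
    (mu : {measure set T -> \bar R}) (A : set T) (f g : T -> R) :
  measurable A -> sqitg mu A f -> sqitg mu A g ->
  0 <= \int[mu]_(x in A) ((f x - g x) ^+ 2) <=
    2 * \int[mu]_(x in A) (f x ^+ 2) + 2 * \int[mu]_(x in A) (g x ^+ 2).
Proof.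
move=> mA F G; have iF := F.2; have iG := G.2; have iB := (sqitgB mA F G).2.
apply/andP; split; first by apply: Rintegral_ge0 => x _; exact: sqr_ge0.
rewrite -!RintegralZl// -RintegralD//; [|exact: itgZ..].
apply: le_Rintegral => //; first by apply: itgD => //; exact: itgZ.
by move=> x _; have := sqr_ge0 (f x + g x); rewrite !expr2; lra.
Qed.

Section dominated.
Context d (T : measurableType d) {R : realType}.
Variables (mu : {measure set T -> \bar R}) (D : set T).
Hypotheses (mD : measurable D) (muD : (mu D < +oo)%E).

Lemma dominated_Rintegral (f_ : nat -> T -> R) (f g : T -> R) :
  (forall n, measurable_fun D (f_ n)) ->
  (forall x, D x -> f_ ^~ x @ \oo --> f x) ->
  mu.-integrable D (EFin \o g) ->
  (forall n x, D x -> `|f_ n x| <= g x) ->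
  mu.-integrable D (EFin \o f) /\
  (fun n => \int[mu]_(x in D) f_ n x) @ \oo --> \int[mu]_(x in D) f x.
Proof.
move=> mf_ f_f ig f_g.
have mf := measurable_fun_cvg mf_ f_f.
have [|||||i _ c] := @dominated_convergence _ _ _ mu D mD
  (fun n x => (f_ n x)%:E) (EFin \o f) (EFin \o g).
- by move=> n; exact/measurable_EFinP.
- exact/measurable_EFinP.
- by apply: aeW => x Dx; apply: cvg_EFin; [exact: nearW|exact: f_f].
- exact: ig.
- by apply: aeW => x n Dx; rewrite /= lee_fin f_g.
split => //; apply: fine_cvg; rewrite (EFin_Rintegral mD i); exact: c.
Qed.

Lemma cvg_L2_bounded (f_ : nat -> T -> R) (f : T -> R) (C : R) :
  (forall n, measurable_fun D (f_ n)) ->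
  (forall x, D x -> f_ ^~ x @ \oo --> f x) ->
  (forall n x, D x -> `|f_ n x| <= C) ->
  [/\ sqitg mu D f, forall x, D x -> `|f x| <= C &
  (fun n => \int[mu]_(x in D) (f_ n x - f x) ^+ 2) @ \oo --> (0 : R)].
Proof.
move=> mf_ f_f f_C.
have mf := measurable_fun_cvg mf_ f_f.
have fC x : D x -> `|f x| <= C.
  move=> Dx; have c : (fun n => `|f_ n x|) @ \oo --> `|f x|.
    by apply: cvg_norm; exact: f_f.
  rewrite -(cvg_lim (@Rhausdorff R) c); apply: limr_le; first exact: cvgP c.
  by apply: nearW => n; exact: f_C.
split => //; first exact: (sqitg_bounded mD muD mf fC).
have [||||_] := @dominated_Rintegral (fun n x => (f_ n x - f x) ^+ 2) (fun=> 0)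
  (fun=> (C + C) ^+ 2).
- by move=> n; apply: measurable_funX; exact: measurable_funB.
- move=> x Dx; rewrite [X in _ --> X](_ : 0 = (0 : R) ^+ 2); last by rewrite expr0n.
  apply: (cvg_continuous (@exprn_continuous R 2)).
  by rewrite -[X in _ --> X](subrr (f x)); apply: cvgB; [exact: f_f|exact: cvg_cst].
- exact: itg_cst.
- move=> n x Dx; rewrite normrX lerXn2r ?nnegrE//.
    by rewrite addr_ge0// (le_trans _ (fC x Dx)).
  by rewrite (le_trans (ler_normB _ _))// lerD ?f_C ?fC.
by rewrite Rintegral_cst// mul0r.
Qed.

End dominated.

Local Notation D := (disc 1).
Local Notation mu := lebesgue_measure.
Local Notation Dint f := (\int[leb2 _]_(z in disc 1) f z).
Local Notation itgd f := ((leb2 _).-integrable (disc 1) (EFin \o f)).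
Local Notation L2D := (sqitg (leb2 _) (disc 1)).
Local Notation Cint f := (\int[lebesgue_measure]_(t in `[0, 2 * pi]) f t).

(** * Zero traces and solenoidal fields *)

Section zero_trace.
Context {R : realType}.

Let mD := @measurable_disc1 R.
Let muD := @disc1_finite R.

Lemma classC1P (f : R * R -> R) (j : 'I_2) : classC 1 f ->
  [/\ continuous f, forall z, is_derive z (basis_vec R j) f (partial j f z) &
      continuous (partial j f)].
Proof.
move=> [cf /(_ j)[df cdf]]; split => // z; exact: derivableP.
Qed.

Lemma L2D_continuous (f : R * R -> R) : continuous f -> L2D f.
Proof.
move=> cf; have [M M0 fM] := continuous_bounded_disc cf.
apply: (sqitg_bounded mD muD) fM.
by apply: measurable_funTS; exact: continuous_measurable_plane.
Qed.

Lemma circle_itg (h : R -> R) : continuous h ->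
  mu.-integrable `[0, 2 * pi] (EFin \o h).
Proof.
move=> ch; apply: continuous_compact_integrable; first exact: segment_compact.
exact: continuous_subspaceT.
Qed.

Lemma circle_length : (@lebesgue_measure R `[0%R, (2 * pi)%R] < +oo)%E.
Proof.
by rewrite lebesgue_measure_itv/=; case: ifPn => _; rewrite -?EFinB ltry.
Qed.

Lemma continuous_circle (f : R * R -> R) : continuous f ->
  continuous (fun t => f (cos t, sin t)).
Proof.
by move=> cf; exact: (continuous_along cf (@continuous_cos R) (@continuous_sin R)).
Qed.

Lemma green_Rintegral (F dF : R * R -> R) (j : 'I_2) :
  continuous F -> (forall z, is_derive z (basis_vec R j) F (dF z)) ->
  continuous dF ->
  `| Dint dF | <= 3 * Cint (fun t => `|F (cos t, sin t)|).
Proof.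
move=> cF dFE cdF; have := green_bound cF dFE cdF.
rewrite -(EFin_Rintegral mD (integrable_continuous_disc cdF)) /circle_int.
have cn := continuous_compR (@norm_continuous _ R) (continuous_circle cF).
rewrite -(EFin_Rintegral _ (circle_itg cn)); last exact: measurable_itv.
rewrite -!EFinD lee_fin.
by move=> /le_trans; apply; lra.
Qed.

(** As in [has_trace], the trace of [phi], with gradient [a], is described through
    approximation by maps of class C^1, whose values on the circle tend to 0. *)
Definition zero_trace (phi : R * R -> R) (a : 'I_2 -> R * R -> R) :=
  exists f : nat -> R * R -> R,
  [/\ forall k, classC 1 (f k),
      (fun k => Dint (fun z => (f k z - phi z) ^+ 2)) @ \oo --> (0 : R),
      forall j, (fun k => Dint (fun z => (partial j (f k) z - a j z) ^+ 2))
        @ \oo --> (0 : R) &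
      (fun k => Cint (fun t => f k (cos t, sin t) ^+ 2)) @ \oo --> (0 : R)].

Lemma circle_L1 (f : nat -> R * R -> R) : (forall k, continuous (f k)) ->
  (fun k => Cint (fun t => f k (cos t, sin t) ^+ 2)) @ \oo --> (0 : R) ->
  (fun k => Cint (fun t => `|f k (cos t, sin t)|)) @ \oo --> (0 : R).
Proof.
move=> cf; apply: cvg_L1_of_L2; [exact: measurable_itv|exact: circle_length|].
move=> k; split.
  apply: measurable_funTS; apply: continuous_measurable_fun.
  exact: continuous_circle.
apply: circle_itg => t; apply: (@continuous_compR R (fun x => x ^+ 2)).
  exact: exprn_continuous.
exact: continuous_circle.
Qed.

(** For an approximation [f k] of [phi], the sum over [j] of the partial
    derivatives of [S j * f k] is [S . grad (f k)], because [S] is divergence free.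
    Its integral is controlled by the integral of [|f k|] on the circle, which
    tends to 0. *)
Lemma solenoidal_orthogonal (S dS : 'I_2 -> R * R -> R)
    (phi : R * R -> R) (a : 'I_2 -> R * R -> R) :
  (forall j, continuous (S j)) ->
  (forall j z, is_derive z (basis_vec R j) (S j) (dS j z)) ->
  (forall j, continuous (dS j)) ->
  (forall z, dS 0 z + dS 1 z = 0) ->
  (forall j, L2D (a j)) -> zero_trace phi a ->
  Dint (fun z => S 0 z * a 0 z + S 1 z * a 1 z) = 0.
Proof.
move=> cS dSE cdS div0 aL2 [f [f1 _ fa fc]].
have [M M0 SM] : exists2 M : R, 0 < M &
    forall j z, (`[-1, 1] `*` `[-1, 1]) z -> `|S j z| <= M.
  have [M0 M00 S0M] := continuous_bounded_square (cS 0).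
  have [M1 M10 S1M] := continuous_bounded_square (cS 1).
  exists (M0 + M1); first exact: addr_gt0.
  move=> j z Dz; move: j; apply: ord2P.
    by rewrite (le_trans (S0M z Dz))// lerDl ltW.
  by rewrite (le_trans (S1M z Dz))// lerDr ltW.
have L2S j := L2D_continuous (cS j).
have cf k : continuous (f k) by have [] := f1 k.
have L2df k j : L2D (partial j (f k)).
  by have [_ _ c] := classC1P j (f1 k); exact: L2D_continuous.
have L2e k j : L2D (fun z => partial j (f k) z - a j z).
  exact: (sqitgB mD (L2df k j) (aL2 j)).
pose A k j := Dint (fun z => `|partial j (f k) z - a j z|).
pose C k := Cint (fun t => `|f k (cos t, sin t)|).
have A0 j : A ^~ j @ \oo --> (0 : R).
  by apply: (cvg_L1_of_L2 mD muD) => [k|]; [exact: L2e|exact: fa].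
have C0 : C @ \oo --> (0 : R) by exact: circle_L1.
have boundary k j : `|Dint (fun z => S j z * partial j (f k) z
    + f k z * dS j z)| <= 3 * (M * C k).
  have [_ df cdf] := classC1P j (f1 k).
  have cSf : continuous (fun z => S j z * f k z).
    by move=> z; apply: cvgM; [exact: cS|exact: cf].
  have dSf z : is_derive z (basis_vec R j) (fun z => S j z * f k z)
      (S j z * partial j (f k) z + f k z * dS j z).
    exact: (is_deriveM (dSE j z) (df z)).
  have cdSf : continuous (fun z => S j z * partial j (f k) z + f k z * dS j z).
    move=> z; apply: cvgD; apply: cvgM;
      [exact: cS|exact: cdf|exact: cf|exact: cdS].
  have g := green_Rintegral cSf dSf cdSf; apply: (le_trans g); rewrite ler_pM2l// {g}.
  have cn := continuous_compR (@norm_continuous _ R) (continuous_circle (cf k)).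
  have cn' := continuous_compR (@norm_continuous _ R) (continuous_circle cSf).
  rewrite /C -RintegralZl//; last exact: circle_itg.
  apply: le_Rintegral; [exact: measurable_itv|exact: circle_itg| |].
    by apply: itgZ; [exact: measurable_itv|exact: circle_itg].
  move=> t _; rewrite normrM ler_wpM2r//; apply: SM.
  by split; rewrite /= in_itv/= ?cos_geN1 ?cos_le1 ?sin_geN1 ?sin_le1.
have bound k : `|Dint (fun z => S 0 z * a 0 z + S 1 z * a 1 z)| <=
    M * A k 0 + M * A k 1 + (3 * (M * C k) + 3 * (M * C k)).
  pose B j z := S j z * partial j (f k) z + f k z * dS j z.
  pose E j z := S j z * (partial j (f k) z - a j z).
  have iB j : itgd (B j).
    have [_ _ cdf] := classC1P j (f1 k).
    apply: (itgD mD); apply: (sqitg_mul mD) => //; exact: L2D_continuous.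
  have iE j : itgd (E j) by exact: (sqitg_mul mD).
  have -> : Dint (fun z => S 0 z * a 0 z + S 1 z * a 1 z) =
      Dint (fun z => (B 0 z + B 1 z) - (E 0 z + E 1 z)).
    apply: eq_Rintegral => z _; rewrite /B /E.
    have -> : dS 1 z = - dS 0 z by have := div0 z; lra.
    by ring.
  rewrite RintegralB//; [|exact: itgD|exact: itgD].
  rewrite (RintegralD mD (iB 0) (iB 1)) (RintegralD mD (iE 0) (iE 1)).
  have E_le j : `|Dint (E j)| <= M * A k j.
    apply: (le_trans (le_normr_Rintegral mD (iE j))).
    rewrite -RintegralZl//; last exact/itg_norm/sqitg_itg.
    apply: le_Rintegral => //; first exact: itg_norm.
      by apply: itgZ => //; exact/itg_norm/sqitg_itg.
    move=> z Dz; rewrite normrM ler_wpM2r//.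
    exact/SM/disc1_square.
  rewrite (le_trans (ler_normB _ _))// addrC lerD//.
    by rewrite (le_trans (ler_normD _ _))// lerD.
  rewrite (le_trans (ler_normD _ _))//; apply: lerD; exact: boundary.
have lim : (fun k => M * A k 0 + M * A k 1 + (3 * (M * C k) + 3 * (M * C k)))
    @ \oo --> (0 : R).
  by do !apply: cvg0_add; do !apply: cvg0_scale.
by apply/eqP; rewrite -normr_le0; exact: (cvg0_le bound lim).
Qed.

End zero_trace.

(** * The Poincare inequality *)

Section poincare.
Context {R : realType}.

Let mD := @measurable_disc1 R.
Let muD := @disc1_finite R.

(** Apply [green_Rintegral] to [x * f^2], whose first partial derivative is
    [f^2 + 2 x f (d_x f)]; since [|x| <= 1], half of the integral of [f^2] absorbs
    the mixed term. *)
Lemma poincare_C1 (f : R * R -> R) : classC 1 f ->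
  Dint (fun z => f z ^+ 2) <= 6 * Cint (fun t => f (cos t, sin t) ^+ 2) +
    4 * Dint (fun z => partial 0 f z ^+ 2).
Proof.
move=> f1; have [cf df cdf] := classC1P 0 f1.
have cf2 : continuous (fun z => f z ^+ 2).
  move=> z; apply: (@continuous_comp _ _ _ f (fun x : R => x ^+ 2)).
    exact: cf.
  exact: exprn_continuous.
pose F z := z.1 * (f z ^+ 2).
pose dF z := f z ^+ 2 + 2 * z.1 * f z * partial 0 f z.
have cF : continuous F.
  by move=> z; apply: cvgM; [exact: continuous_fst_plane|exact: cf2].
have dFE z : is_derive z (basis_vec R 0) F (dF z).
  have d1 : is_derive z (basis_vec R 0) fst 1.
    by case: z => x y; apply/is_derive_slice1; exact: is_derive_id.
  have d2 := is_deriveM d1 (is_deriveM (df z) (df z)).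
  apply: (is_derive_eq d2).
  by rewrite /dF /GRing.scale/= !fctE; ring.
have ci : continuous (fun z : R * R => 2 * z.1 * f z * partial 0 f z).
  move=> z; apply: cvgM; last exact: cdf.
  apply: cvgM; last exact: cf.
  by apply: cvgM; [exact: cvg_cst|exact: continuous_fst_plane].
have cdF : continuous dF.
  by move=> z; apply: cvgD; [exact: cf2|exact: ci].
have i1 := integrable_continuous_disc cf2.
have i2 := integrable_continuous_disc ci.
have i3 : itgd (fun z => partial 0 f z ^+ 2).
  by have [] := L2D_continuous cdf.
have := green_Rintegral cF dFE cdF; rewrite /dF RintegralD//.
have le1 : Cint (fun t => `|F (cos t, sin t)|) <=
    Cint (fun t => f (cos t, sin t) ^+ 2).
  apply: le_Rintegral; first exact: measurable_itv.
  - apply: circle_itg.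
    exact: (continuous_compR (@norm_continuous _ R) (continuous_circle cF)).
  - by apply: circle_itg; exact: (continuous_circle cf2).
  - move=> t _; rewrite /F/= normrM (ger0_norm (sqr_ge0 _)).
    by rewrite ler_piMl ?sqr_ge0// cos_max.
have le2 : - Dint (fun z => 2 * z.1 * f z * partial 0 f z) <=
    2^-1 * Dint (fun z => f z ^+ 2) + 2 * Dint (fun z => partial 0 f z ^+ 2).
  rewrite -!RintegralZl//.
  rewrite -RintegralD//; [|exact: itgZ..].
  rewrite -mulN1r -RintegralZl//; apply: le_Rintegral => //; first exact: itgZ.
    by apply: itgD => //; exact: itgZ.
  move=> z /disc1_square[/= + _]; rewrite in_itv/= => /andP[z1 z2].
  set p := partial 0 f z; set q := f z.
  have x1 : z.1 ^+ 2 <= 1 by nra.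
  have : 0 <= (q + 2 * z.1 * p) ^+ 2 by exact: sqr_ge0.
  have : 0 <= (1 - z.1 ^+ 2) * p ^+ 2.
    by rewrite mulr_ge0 ?sqr_ge0// subr_ge0.
  by rewrite !expr2; lra.
move=> /ler_normlP[_]; move: le1 le2.
by move: (Rintegral _ _ _) (Rintegral _ _ _) (Rintegral _ _ _)
  (Rintegral _ _ _) (Rintegral _ _ _) => *; lra.
Qed.

Lemma zero_trace_poincare (phi : R * R -> R) (a : 'I_2 -> R * R -> R) :
  L2D phi -> L2D (a 0) -> zero_trace phi a ->
  Dint (fun z => a 0 z ^+ 2) = 0 -> Dint (fun z => phi z ^+ 2) = 0.
Proof.
move=> L2phi L2a [f [f1 fphi fa fc]] a0.
have L2f k : L2D (f k) by apply: L2D_continuous; have [] := f1 k.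
have L2df k : L2D (partial 0 (f k)).
  by have [_ _ c] := classC1P 0 (f1 k); exact: L2D_continuous.
have i1 k : itgd (fun z => (f k z - phi z) ^+ 2).
  by have [] := sqitgB mD (L2f k) L2phi.
have i2 k : itgd (fun z => f k z ^+ 2) by have [] := L2f k.
have i3 : itgd (fun z => phi z ^+ 2) by have [] := L2phi.
have i4 k : itgd (fun z => (partial 0 (f k) z - a 0 z) ^+ 2).
  by have [] := sqitgB mD (L2df k) L2a.
have i5 : itgd (fun z => a 0 z ^+ 2) by have [] := L2a.
have i6 k : itgd (fun z => partial 0 (f k) z ^+ 2) by have [] := L2df k.
have bound k : Dint (fun z => phi z ^+ 2) <=
    2 * Dint (fun z => (f k z - phi z) ^+ 2) +
    (12 * Cint (fun t => f k (cos t, sin t) ^+ 2) +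
    16 * Dint (fun z => (partial 0 (f k) z - a 0 z) ^+ 2)).
  have h1 : Dint (fun z => phi z ^+ 2) <=
      2 * Dint (fun z => (f k z - phi z) ^+ 2) + 2 * Dint (fun z => f k z ^+ 2).
    rewrite -!RintegralZl// -RintegralD//; [|exact: itgZ..].
    apply: le_Rintegral => //; first by apply: itgD => //; exact: itgZ.
    move=> z _; have := sqr_ge0 (2 * f k z - phi z).
    by rewrite !expr2; lra.
  have h2 : Dint (fun z => partial 0 (f k) z ^+ 2) <=
      2 * Dint (fun z => (partial 0 (f k) z - a 0 z) ^+ 2) +
      2 * Dint (fun z => a 0 z ^+ 2).
    rewrite -!RintegralZl// -RintegralD//; [|exact: itgZ..].
    apply: le_Rintegral => //; first by apply: itgD => //; exact: itgZ.
    move=> z _; have := sqr_ge0 (partial 0 (f k) z - 2 * a 0 z).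
    by rewrite !expr2; lra.
  move: h1 h2 (poincare_C1 (f1 k)); rewrite a0.
  by move: (Rintegral _ _ _) (Rintegral _ _ _) (Rintegral _ _ _)
    (Rintegral _ _ _) (Rintegral _ _ _) => *; lra.
apply/eqP; rewrite eq_le; apply/andP; split; last first.
  by apply: Rintegral_ge0 => z _; exact: sqr_ge0.
apply: (cvg0_le bound).
by do !apply: cvg0_add; apply: cvg0_scale.
Qed.

End poincare.

(** * Smoothing of the radial profile *)

Section profile.
Context {R : realType}.

Lemma is_deriveVR (f : R -> R) (x df : R) : f x != 0 ->
  is_derive x 1 f df -> is_derive x 1 (fun y => (f y)^-1) (- (f x) ^- 2 * df).
Proof.
move=> fx0 [d1 d2]; split; first exact: derivableV.
by rewrite deriveV// d2.
Qed.

(** The function [1 / max(s, rho^2)]; with [s = |x|^2] it gives the two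
    expressions of [u] at once. *)
Definition profile (rho s : R) : R := if s < rho ^+ 2 then rho ^- 2 else s^-1.

(** At the kink [s = rho^2] this is the derivative from the right. *)
Definition profile' (rho s : R) : R := if s < rho ^+ 2 then 0 else - s ^- 2.

Variables (rho e : R).
Hypotheses (rho0 : 0 < rho) (e0 : 0 < e) (er : e <= rho ^+ 2).

Let p (s : R) := s - (rho ^+ 2 - e).
Let q (s : R) := p s ^+ 2 + e ^+ 4.
Let rt (s : R) := Num.sqrt (q s).
Let m (s : R) := (s + rho ^+ 2 + rt s) / 2.
Let m' (s : R) := (1 + p s / rt s) / 2.
Let m'' (s : R) := (1 + p s * - (rt s) ^- 2 * p s) / rt s / 2.

(** In [max(s, rho^2) = (s + rho^2 + |s - rho^2|) / 2] the absolute value is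
    replaced by [sqrt ((s - rho^2 + e)^2 + e^4)].  The term [e^4] makes it smooth.
    The shift by [e], much larger than [e^2], makes the derivative converge to
    [profile'] at the kink too. *)
Definition smooth_profile (s : R) := (m s)^-1.
Definition smooth_profile' (s : R) := - (m s) ^- 2 * m' s.
Definition smooth_profile'' (s : R) :=
  - ((m s) ^- 2 * m'' s + m' s * (2 * smooth_profile s * smooth_profile' s)).

Let q_gt0 s : 0 < q s.
Proof. by rewrite ltr_wpDl ?sqr_ge0// exprn_gt0. Qed.

Let rt_gt0 s : 0 < rt s.
Proof. by rewrite sqrtr_gt0. Qed.

Let rt_ge s : `|p s| <= rt s.
Proof. by rewrite -sqrtr_sqr ler_wsqrtr// lerDl exprn_ge0// ltW. Qed.

Let m_ge s : rho ^+ 2 / 2 <= m s.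
Proof.
have := rt_ge s; rewrite ler_norml /m => /andP[+ _].
by move: er; rewrite {1}/p; move: (rt s) (rho ^+ 2) => x y; lra.
Qed.

Let m_gt0 s : 0 < m s.
Proof. by apply: lt_le_trans (m_ge s); rewrite divr_gt0// exprn_gt0. Qed.

Let m'_bnd s : 0 <= m' s <= 1.
Proof.
have : `|p s / rt s| <= 1.
  by rewrite normrM normfV (gtr0_norm (rt_gt0 s)) ler_pdivrMr// mul1r.
by rewrite ler_norml /m' => /andP[? ?]; lra.
Qed.

Lemma smooth_profile_bound s :
  `|smooth_profile s| <= 2 / rho ^+ 2.
Proof.
rewrite /smooth_profile gtr0_norm ?invr_gt0// -[leRHS]invf_div.
by rewrite lef_pV2 ?posrE// divr_gt0// exprn_gt0.
Qed.

Lemma smooth_profile'_bound s :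
  `|smooth_profile' s| <= (2 / rho ^+ 2) ^+ 2.
Proof.
have /andP[h1 h2] := m'_bnd s.
rewrite /smooth_profile' normrM normrN (ger0_norm h1) -exprVn normrX.
rewrite -[leRHS]mulr1 ler_pM ?exprn_ge0//.
by rewrite lerXn2r ?nnegrE ?divr_ge0 ?exprn_ge0 ?(ltW rho0)// smooth_profile_bound.
Qed.

Let dp (s : R) : is_derive s 1 p 1.
Proof.
have := @is_deriveD _ _ _ id (cst (- (rho ^+ 2 - e))) s 1 1 0
  (is_derive_id _ _) (is_derive_cst _ _ _).
by rewrite addr0.
Qed.

Let dq (s : R) : is_derive s 1 q (2 * p s).
Proof.
have := is_deriveD (is_deriveM (dp s) (dp s)) (is_derive_cst (e ^+ 4 : R) s (1 : R)).
move=> d; apply: (is_derive_eq d).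
by rewrite addr0 /GRing.scale/= mulr1 mulr2n mulrDl mul1r.
Qed.

Let drt (s : R) : is_derive s 1 rt (p s / rt s).
Proof.
have d := is_derive1_comp (is_derive1_sqrt (q_gt0 s)) (dq s).
apply: (is_derive_eq d); rewrite -/(rt s).
by have r0 := rt_gt0 s; field; rewrite gt_eqF.
Qed.

Let dm (s : R) : is_derive s 1 m (m' s).
Proof.
have d1 := is_deriveD (is_deriveD (is_derive_id s (1 : R))
  (is_derive_cst (rho ^+ 2 : R) s (1 : R))) (drt s).
have d := is_deriveM d1 (is_derive_cst (2^-1 : R) s (1 : R)).
apply: (is_derive_eq d).
by rewrite /m' /GRing.scale/= mulr0 add0r addr0 mulrC.
Qed.

Let dm' (s : R) : is_derive s 1 m' (m'' s).
Proof.
have r0 : rt s != 0 by rewrite gt_eqF.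
have d1 := is_deriveD (is_derive_cst (1 : R) s (1 : R))
  (is_deriveM (dp s) (is_deriveVR r0 (drt s))).
have d := is_deriveM d1 (is_derive_cst (2^-1 : R) s (1 : R)).
apply: (is_derive_eq d).
by rewrite /m'' /GRing.scale/=; field.
Qed.

Lemma is_derive_smooth_profile (s : R) :
  is_derive s 1 smooth_profile (smooth_profile' s).
Proof. by apply: is_deriveVR; [rewrite gt_eqF|exact: dm]. Qed.

Lemma is_derive_smooth_profile' (s : R) :
  is_derive s 1 smooth_profile' (smooth_profile'' s).
Proof.
have d0 := is_derive_smooth_profile s.
have d := is_deriveN (is_deriveM (is_deriveM d0 d0) (dm' s)).
have -> : smooth_profile' = - (smooth_profile * smooth_profile * m').
  apply/funext => t; rewrite /smooth_profile' -exprVn expr2 mulNr.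
  by [].
apply: (is_derive_eq d).
rewrite /smooth_profile'' /GRing.scale/= !fctE -exprVn -/(smooth_profile s) expr2.
by ring.
Qed.

Lemma continuous_smooth_profile'' : continuous smooth_profile''.
Proof.
have cp := is_derive_continuous dp.
have crV : continuous (fun s => (rt s)^-1).
  move=> s; apply: cvgV; first by rewrite gt_eqF.
  exact: (is_derive_continuous drt).
have cm' := is_derive_continuous dm'.
have ch := is_derive_continuous is_derive_smooth_profile.
have ch' := is_derive_continuous is_derive_smooth_profile'.
have cm'' : continuous m''.
  have -> : m'' = fun s => (1 + p s * - ((rt s)^-1 * (rt s)^-1) * p s)
      * (rt s)^-1 * 2^-1.
    by apply/funext => s; rewrite /m'' -exprVn expr2.
  move=> s; apply: cvgM; last exact: cvg_cst.
  apply: cvgM; last exact: crV.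
  apply: cvgD; first exact: cvg_cst.
  apply: cvgM; last exact: cp.
  apply: cvgM; first exact: cp.
  by apply: cvgN; apply: cvgM; exact: crV.
have -> : smooth_profile'' = fun s => - (smooth_profile s * smooth_profile s *
    m'' s + m' s * (2 * smooth_profile s * smooth_profile' s)).
  by apply/funext => s; rewrite /smooth_profile'' -exprVn expr2.
move=> s; apply: cvgN; apply: cvgD; apply: cvgM.
- by apply: cvgM; exact: ch.
- exact: cm''.
- exact: cm'.
- apply: cvgM; last exact: ch'.
  by apply: cvgM; [exact: cvg_cst|exact: ch].
Qed.

End profile.

Section profile_limit.
Context {R : realType}.
Variables (rho : R) (rho0 : 0 < rho).

(** These widths are at most [rho^2], as required for [smooth_profile] to be
    bounded independently of the width. *)
Definition width (n : nat) : R := rho ^+ 2 / n.+1%:R.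

Lemma width_gt0 n : 0 < width n.
Proof. by rewrite divr_gt0 ?exprn_gt0. Qed.

Lemma width_le n : width n <= rho ^+ 2.
Proof. by rewrite ler_pdivrMr// ler_peMr ?ler1n// exprn_ge0// ltW. Qed.

Lemma cvg_width : width @ \oo --> (0 : R).
Proof.
rewrite -[X in _ --> X](mulr0 (rho ^+ 2)).
by apply: cvgM; [exact: cvg_cst|exact: cvg_harmonic].
Qed.

Let cvg_p (s : R) : (fun n => s - (rho ^+ 2 - width n)) @ \oo --> s - rho ^+ 2.
Proof.
rewrite -[X in _ --> _ - X]subr0.
apply: cvgB; first exact: cvg_cst.
by apply: cvgB; [exact: cvg_cst|exact: cvg_width].
Qed.

Let cvg_rt (s : R) :
  (fun n => Num.sqrt ((s - (rho ^+ 2 - width n)) ^+ 2 + width n ^+ 4)) @ \oo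
  --> `|s - rho ^+ 2|.
Proof.
rewrite -sqrtr_sqr; apply: (cvg_continuous (@sqrt_continuous R)).
rewrite -[X in _ --> X]addr0; apply: cvgD.
  apply: (cvg_continuous (@exprn_continuous R 2)).
  exact: cvg_p.
have -> : (0 : R) = 0 ^+ 4 by rewrite expr0n.
apply: (cvg_continuous (@exprn_continuous R 4)).
exact: cvg_width.
Qed.

Let max_gt0 (s : R) : 0 < (s + rho ^+ 2 + `|s - rho ^+ 2|) / 2.
Proof.
have r2 : 0 < rho ^+ 2 by rewrite exprn_gt0.
by have [|] := ger0P (s - rho ^+ 2); lra.
Qed.

Let cvg_mV (s : R) : (fun n => ((s + rho ^+ 2 +
  Num.sqrt ((s - (rho ^+ 2 - width n)) ^+ 2 + width n ^+ 4)) / 2)^-1) @ \oo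
  --> ((s + rho ^+ 2 + `|s - rho ^+ 2|) / 2)^-1.
Proof.
apply: cvgV; first by rewrite gt_eqF.
apply: cvgM; last exact: cvg_cst.
by apply: cvgD; [exact: cvg_cst|exact: cvg_rt].
Qed.

Let maxE (s : R) : ((s + rho ^+ 2 + `|s - rho ^+ 2|) / 2)^-1 = profile rho s.
Proof.
rewrite /profile; case: ltP => h.
  by rewrite ltr0_norm ?subr_lt0//; congr (_^-1); lra.
by rewrite ger0_norm ?subr_ge0//; congr (_^-1); lra.
Qed.

Lemma cvg_smooth_profile (s : R) :
  (fun n => smooth_profile rho (width n) s) @ \oo --> profile rho s.
Proof. by rewrite -maxE; exact: cvg_mV. Qed.

Let cvg_sign (s : R) : (fun n => (s - (rho ^+ 2 - width n)) /
    Num.sqrt ((s - (rho ^+ 2 - width n)) ^+ 2 + width n ^+ 4)) @ \oo -->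
  (if s < rho ^+ 2 then -1 else 1 : R).
Proof.
have [sr|sr] := eqVneq s (rho ^+ 2).
  rewrite sr ltxx.
  (* at the kink the quotient is width / sqrt (width^2 + width^4) *)
  have -> : (fun n => (rho ^+ 2 - (rho ^+ 2 - width n)) /
      Num.sqrt ((rho ^+ 2 - (rho ^+ 2 - width n)) ^+ 2 + width n ^+ 4)) =
      (fun n => (Num.sqrt (1 + width n ^+ 2))^-1).
    apply/funext => n; rewrite subKr.
    have w0 := width_gt0 n.
    have -> : width n ^+ 2 + width n ^+ 4 = width n ^+ 2 * (1 + width n ^+ 2).
      by ring.
    rewrite sqrtrM ?sqr_ge0// sqrtr_sqr gtr0_norm// invfM mulrA divff ?mul1r//.
    by rewrite gt_eqF.
  rewrite -[X in _ --> X]invr1; apply: cvgV; first exact: oner_neq0.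
  rewrite -[X in _ --> X]sqrtr1; apply: (cvg_continuous (@sqrt_continuous R)).
  rewrite -[X in _ --> X]addr0; apply: cvgD; first exact: cvg_cst.
  have -> : (0 : R) = 0 ^+ 2 by rewrite expr0n.
  apply: (cvg_continuous (@exprn_continuous R 2)).
  exact: cvg_width.
have n0 : s - rho ^+ 2 != 0 by rewrite subr_eq0.
have -> : (if s < rho ^+ 2 then -1 else 1 : R) =
    (s - rho ^+ 2) / `|s - rho ^+ 2|.
  case: ltP => h.
    by rewrite ltr0_norm ?subr_lt0// invrN mulrN divff.
  by rewrite ger0_norm ?subr_ge0// divff.
apply: cvgM; first exact: cvg_p.
by apply: cvgV; [rewrite normr_eq0|exact: cvg_rt].
Qed.

Lemma cvg_smooth_profile' (s : R) :
  (fun n => smooth_profile' rho (width n) s) @ \oo --> profile' rho s.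
Proof.
have -> : profile' rho s = - (profile rho s * profile rho s) *
    ((1 + (if s < rho ^+ 2 then -1 else 1 : R)) / 2).
  rewrite /profile' /profile; case: ltP => h; first by rewrite subrr mul0r mulr0.
  have -> : (1 + 1) / 2 = 1 :> R by field.
  by rewrite mulr1 -exprVn expr2.
apply: cvgM.
  rewrite -maxE; apply: cvgN.
  have -> : (fun n => ((s + rho ^+ 2 + Num.sqrt ((s - (rho ^+ 2 - width n)) ^+ 2
      + width n ^+ 4)) / 2) ^- 2) = (fun n => smooth_profile rho (width n) s *
      smooth_profile rho (width n) s).
    by apply/funext => n; rewrite -exprVn expr2.
  by apply: cvgM; exact: cvg_mV.
apply: cvgM; last exact: cvg_cst.
by apply: cvgD; [exact: cvg_cst|exact: cvg_sign].
Qed.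

End profile_limit.

(** * Radial maps and their cofactor matrices *)

Section radial.
Context {R : realType}.

Lemma continuous_cpt i : continuous (fun z : R * R => cpt z i).
Proof.
by move: i; apply: ord2P; [exact: continuous_fst_plane|exact: continuous_snd_plane].
Qed.

Lemma is_derive_cpt (z : R * R) (i j : 'I_2) :
  is_derive z (basis_vec R j) (fun z : R * R => cpt z i) (i == j)%:R.
Proof.
case: z => x y; move: i j; apply: ord2P; apply: ord2P.
- by apply/is_derive_slice1; exact: is_derive_id.
- by apply/is_derive_slice2; exact: is_derive_cst.
- by apply/is_derive_slice1; exact: is_derive_cst.
- by apply/is_derive_slice2; exact: is_derive_id.
Qed.

Lemma is_derive_radial (k k' : R -> R) (z : R * R) (j : 'I_2) :
  (forall s : R, is_derive s 1 k (k' s)) ->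
  is_derive z (basis_vec R j) (fun z => k (sqn z)) (2 * cpt z j * k' (sqn z)).
Proof.
move=> dk; case: z => x y; move: j; apply: ord2P.
- apply/is_derive_slice1.
  have d1 : is_derive x 1 (fun t : R => sqn (t, y)) (2 * x).
    have d := is_deriveD (is_deriveM (is_derive_id x (1 : R)) (is_derive_id x (1 : R)))
      (is_derive_cst (y ^+ 2 : R) x (1 : R)).
    by apply: (is_derive_eq d); rewrite /GRing.scale/=; ring.
  have d := @is_derive1_comp _ k (fun t : R => sqn (t, y)) x _ _ (dk _) d1.
  by apply: (is_derive_eq d); rewrite cpt0/= mulrC.
- apply/is_derive_slice2.
  have d1 : is_derive y 1 (fun t : R => sqn (x, t)) (2 * y).
    have d := is_deriveD (is_derive_cst (x ^+ 2 : R) y (1 : R))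
      (is_deriveM (is_derive_id y (1 : R)) (is_derive_id y (1 : R))).
    by apply: (is_derive_eq d); rewrite /GRing.scale/=; ring.
  have d := @is_derive1_comp _ k (fun t : R => sqn (x, t)) y _ _ (dk _) d1.
  by apply: (is_derive_eq d); rewrite cpt1/= mulrC.
Qed.

Lemma continuous_radial (k : R -> R) : continuous k ->
  continuous (fun z : R * R => k (sqn z)).
Proof.
move=> ck z; apply: (@continuous_comp _ _ _ (@sqn R) k); last exact: ck.
exact: continuous_sqn.
Qed.

Lemma classC1_intro (f : R * R -> R) (df : 'I_2 -> R * R -> R) :
  (forall j z, is_derive z (basis_vec R j) f (df j z)) ->
  continuous f -> (forall j, continuous (df j)) ->
  classC 1 f /\ forall j, partial j f = df j.
Proof.
move=> dE cf cdf.
have pE j : partial j f = df j.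
  by apply/funext => z; rewrite /partial; have [] := dE j z.
split => //; split => // j; split; last by rewrite pE; exact: cdf.
by move=> z; have [] := dE j z.
Qed.

Definition radial_map (k : R -> R) (i : 'I_2) (z : R * R) : R := k (sqn z) * cpt z i.

(** The entry [(i, j)] is the [j]-th partial derivative of [radial_map k i], when
    [k'] is the derivative of [k]. *)
Definition radial_grad (k k' : R -> R) (i j : 'I_2) (z : R * R) : R :=
  k (sqn z) * (i == j)%:R + 2 * k' (sqn z) * cpt z i * cpt z j.

(** The cofactor matrix of [radial_grad]: the diagonal entries exchange the
    squares of the two coordinates, whose sum is [sqn z]. *)
Definition radial_cof (k k' : R -> R) (i j : 'I_2) (z : R * R) : R :=
  k (sqn z) * (i == j)%:R +
  2 * k' (sqn z) * ((i == j)%:R * sqn z - cpt z i * cpt z j).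

Variables (k k' k'' : R -> R).
Hypotheses (dk : forall s : R, is_derive s 1 k (k' s))
  (dk' : forall s : R, is_derive s 1 k' (k'' s)) (ck'' : continuous k'').

Let ck : continuous k. Proof. exact: is_derive_continuous dk. Qed.
Let ck' : continuous k'. Proof. exact: is_derive_continuous dk'. Qed.

Lemma continuous_radial_map i : continuous (radial_map k i).
Proof.
by move=> z; apply: cvgM; [exact: (continuous_radial ck)|exact: continuous_cpt].
Qed.

Lemma is_derive_radial_map i j z :
  is_derive z (basis_vec R j) (radial_map k i) (radial_grad k k' i j z).
Proof.
have d := is_deriveM (is_derive_radial z j dk) (is_derive_cpt z i j).
by apply: (is_derive_eq d); rewrite /radial_grad /GRing.scale/=; ring.
Qed.

Lemma continuous_cpt_mul i j : continuous (fun z : R * R => cpt z i * cpt z j).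
Proof. by move=> z; apply: cvgM; exact: continuous_cpt. Qed.

Lemma continuous_radial_grad i j : continuous (radial_grad k k' i j).
Proof.
move=> z; apply: cvgD.
  by apply: cvgM; [exact: (continuous_radial ck)|exact: cvg_cst].
apply: cvgM; last exact: continuous_cpt.
apply: cvgM; last exact: continuous_cpt.
by apply: cvgM; [exact: cvg_cst|exact: (continuous_radial ck')].
Qed.

Lemma radial_map_classC1 i :
  classC 1 (radial_map k i) /\ forall j, partial j (radial_map k i) = radial_grad k k' i j.
Proof.
apply: classC1_intro; [|exact: continuous_radial_map|exact: continuous_radial_grad].
exact: is_derive_radial_map.
Qed.

(** The [j]-th partial derivative of the entry [(i, j)] of [radial_cof]: up to
    sign it is the same for both [j]. *)
Definition dradial_cof (i j : 'I_2) (z : R * R) : R :=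
  (if i == j then 1 else -1) * (2 * k' (sqn z) * cpt z i +
    4 * k'' (sqn z) * cpt z i * (sqn z - cpt z i ^+ 2)).

Lemma is_derive_radial_cof i j z :
  is_derive z (basis_vec R j) (radial_cof k k' i j) (dradial_cof i j z).
Proof.
have d2 : is_derive z (basis_vec R j) (@sqn R) (2 * cpt z j).
  have d := is_deriveD (is_deriveM (is_derive_cpt z 0 j) (is_derive_cpt z 0 j))
    (is_deriveM (is_derive_cpt z 1 j) (is_derive_cpt z 1 j)).
  apply: (is_derive_eq d); rewrite /GRing.scale/=.
  by move: j {d}; apply: ord2P; rewrite /=; ring.
have c l := is_derive_cpt z l j.
have cs (x : R) : is_derive z (basis_vec R j) (fun=> x) 0.
  exact: (is_derive_cst x z (basis_vec R j)).
have dkk := is_derive_radial z j dk.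
have dkk' := is_derive_radial z j dk'.
have d := is_deriveD (is_deriveM dkk (cs (i == j)%:R))
  (is_deriveM (is_deriveM (cs 2) dkk')
    (is_deriveB (is_deriveM (cs (i == j)%:R) d2) (is_deriveM (c i) (c j)))).
apply: (is_derive_eq d); rewrite /dradial_cof /GRing.scale/= !fctE.
move: i j {c cs dkk dkk' d d2}; apply: ord2P; apply: ord2P;
  by rewrite /sqn /cpt /=; ring.
Qed.

Lemma continuous_radial_cof i j : continuous (radial_cof k k' i j).
Proof.
move=> z; apply: cvgD.
  by apply: cvgM; [exact: (continuous_radial ck)|exact: cvg_cst].
apply: cvgM.
  by apply: cvgM; [exact: cvg_cst|exact: (continuous_radial ck')].
apply: cvgB; last exact: continuous_cpt_mul.
by apply: cvgM; [exact: cvg_cst|exact: continuous_sqn].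
Qed.

Lemma continuous_dradial_cof i j : continuous (dradial_cof i j).
Proof.
move=> z; apply: cvgM; first exact: cvg_cst.
apply: cvgD.
  apply: cvgM; last exact: continuous_cpt.
  by apply: cvgM; [exact: cvg_cst|exact: (continuous_radial ck')].
apply: cvgM.
  apply: cvgM; last exact: continuous_cpt.
  by apply: cvgM; [exact: cvg_cst|exact: (continuous_radial ck'')].
by apply: cvgB; [exact: continuous_sqn|exact: continuous_cpt_mul].
Qed.

(** The rows of a cofactor matrix are divergence free (Piola identity). *)
Lemma dradial_cof_div i z : dradial_cof i 0 z + dradial_cof i 1 z = 0.
Proof.
by move: i; apply: ord2P; rewrite /dradial_cof/= -mulrDl ?subrr ?addNr mul0r.
Qed.

End radial.

(** * Limits of smoothed radial maps *)

Section radial_limit.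
Context {R : realType}.

Let mD := @measurable_disc1 R.
Let muD := @disc1_finite R.

Variables (rho : R) (rho0 : 0 < rho) (al ga : R).

Definition coef (s : R) := al + ga * profile rho s.
Definition coef' (s : R) := ga * profile' rho s.

Let c_ n (s : R) := al + ga * smooth_profile rho (width rho n) s.
Let c'_ n (s : R) := ga * smooth_profile' rho (width rho n) s.
Let c''_ n (s : R) := ga * smooth_profile'' rho (width rho n) s.

Let wgt0 := width_gt0 rho0.
Let wle := width_le rho0.

Let dc n (s : R) : is_derive s 1 (c_ n) (c'_ n s).
Proof.
have d := is_deriveD (is_derive_cst (al : R) s (1 : R))
  (is_deriveM (is_derive_cst (ga : R) s (1 : R))
     (is_derive_smooth_profile rho0 (wgt0 n) (wle n) s)).
by apply: (is_derive_eq d); rewrite /c'_ /GRing.scale/= mulr0 addr0 add0r.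
Qed.

Let dc' n (s : R) : is_derive s 1 (c'_ n) (c''_ n s).
Proof.
have d := is_deriveM (is_derive_cst (ga : R) s (1 : R))
     (is_derive_smooth_profile' rho0 (wgt0 n) (wle n) s).
by apply: (is_derive_eq d); rewrite /c''_ /GRing.scale/= mulr0 addr0.
Qed.

Let cc'' n : continuous (c''_ n).
Proof.
move=> s; apply: cvgM; first exact: cvg_cst.
exact: (continuous_smooth_profile'' rho0 (wgt0 n) (wle n)).
Qed.

Let cvg_c s : c_ ^~ s @ \oo --> coef s.
Proof.
apply: cvgD; first exact: cvg_cst.
by apply: cvgM; [exact: cvg_cst|exact: cvg_smooth_profile].
Qed.

Let cvg_c' s : c'_ ^~ s @ \oo --> coef' s.
Proof. by apply: cvgM; [exact: cvg_cst|exact: cvg_smooth_profile']. Qed.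

Let B := 2 / rho ^+ 2.

Let B0 : 0 <= B.
Proof. by rewrite divr_ge0// exprn_ge0// ltW. Qed.

Let K := `|al| + `|ga| * B.
Let K' := `|ga| * B ^+ 2.

Let K0 : 0 <= K. Proof. by rewrite addr_ge0// mulr_ge0. Qed.
Let K'0 : 0 <= K'. Proof. by rewrite mulr_ge0// exprn_ge0. Qed.

Let c_bnd n s : `|c_ n s| <= K.
Proof.
rewrite (le_trans (ler_normD _ _))// lerD// normrM ler_wpM2l//.
exact: (smooth_profile_bound rho0 (wgt0 n) (wle n)).
Qed.

Let c'_bnd n s : `|c'_ n s| <= K'.
Proof.
rewrite normrM ler_wpM2l//.
exact: (smooth_profile'_bound rho0 (wgt0 n) (wle n)).
Qed.

Lemma cpt_bound (z : R * R) i : D z -> `|cpt z i| <= 1.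
Proof.
move=> /disc1_square[]; rewrite /= !in_itv/= -!ler_norml => z1 z2.
by move: i; exact: ord2P.
Qed.

Let le_normM (x y X Y : R) : `|x| <= X -> `|y| <= Y -> `|x * y| <= X * Y.
Proof. by move=> h1 h2; rewrite normrM ler_pM. Qed.

Let rad_bnd n z i : D z -> `|radial_map (c_ n) i z| <= K.
Proof.
move=> Dz; rewrite /radial_map -[leRHS]mulr1.
by apply: le_normM; [exact: c_bnd|exact: cpt_bound].
Qed.

Let delta_bnd (i j : 'I_2) : `|(i == j)%:R : R| <= 1.
Proof. by case: eqP; rewrite ?normr1 ?normr0. Qed.

Let c2_bnd n s : `|2 * c'_ n s| <= 2 * K'.
Proof. by apply: le_normM; [rewrite ger0_norm|exact: c'_bnd]. Qed.

Let cpt2_bnd (z : R * R) i j : D z -> `|cpt z i * cpt z j| <= 1.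
Proof.
by move=> Dz; rewrite -[leRHS]mulr1; apply: le_normM; exact: cpt_bound.
Qed.

Let radial_grad_bnd n z i j : D z -> `|radial_grad (c_ n) (c'_ n) i j z| <= K + 2 * K'.
Proof.
move=> Dz; rewrite (le_trans (ler_normD _ _))//; apply: lerD.
  by rewrite -[leRHS]mulr1; apply: le_normM; [exact: c_bnd|exact: delta_bnd].
rewrite -[leRHS]mulr1 -mulrA; apply: le_normM; first exact: c2_bnd.
exact: cpt2_bnd.
Qed.

Let radial_cof_bnd n z i j :
  D z -> `|radial_cof (c_ n) (c'_ n) i j z| <= K + 2 * K' * 2.
Proof.
move=> Dz; rewrite (le_trans (ler_normD _ _))//; apply: lerD.
  by rewrite -[leRHS]mulr1; apply: le_normM; [exact: c_bnd|exact: delta_bnd].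
apply: le_normM; first exact: c2_bnd.
rewrite [leRHS](_ : 2 = 1 + 1); last by ring.
rewrite (le_trans (ler_normB _ _))//; apply: lerD; last exact: cpt2_bnd.
rewrite -[leRHS]mulr1; apply: le_normM; first exact: delta_bnd.
rewrite ger0_norm ?sqn_ge0//.
by move: Dz; rewrite disc1E => /ltW.
Qed.

Let cvg_rad i z : (fun n => radial_map (c_ n) i z) @ \oo --> radial_map coef i z.
Proof. by apply: cvgM; [exact: cvg_c|exact: cvg_cst]. Qed.

Let cvg_radial_grad i j z :
  (fun n => radial_grad (c_ n) (c'_ n) i j z) @ \oo --> radial_grad coef coef' i j z.
Proof.
apply: cvgD; first by apply: cvgM; [exact: cvg_c|exact: cvg_cst].
apply: cvgM; last exact: cvg_cst.
apply: cvgM; last exact: cvg_cst.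
by apply: cvgM; [exact: cvg_cst|exact: cvg_c'].
Qed.

Let cvg_rad_cof i j z :
  (fun n => radial_cof (c_ n) (c'_ n) i j z) @ \oo --> radial_cof coef coef' i j z.
Proof.
apply: cvgD; first by apply: cvgM; [exact: cvg_c|exact: cvg_cst].
apply: cvgM; last exact: cvg_cst.
by apply: cvgM; [exact: cvg_cst|exact: cvg_c'].
Qed.

Let mcont (f : R * R -> R) : continuous f -> measurable_fun (D : set (plane R)) f.
Proof. by move=> cf; apply: measurable_funTS; exact: continuous_measurable_plane. Qed.

Lemma radial_cof_L2 i j : L2D (radial_cof coef coef' i j).
Proof.
have [|||// _ _] := @cvg_L2_bounded _ (plane R) R (leb2 R) D mD muD
  (fun n => radial_cof (c_ n) (c'_ n) i j) (radial_cof coef coef' i j) (K + 2 * K' * 2).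
- move=> n; apply: mcont.
  exact: (continuous_radial_cof (dc n) (dc' n)).
- by move=> z _; exact: cvg_rad_cof.
- by move=> n z; exact: radial_cof_bnd.
Qed.

(** The field jumps on the circle of radius [rho], so [solenoidal_orthogonal]
    applies to its smoothings only; these are uniformly bounded and converge
    everywhere. *)
Lemma radial_cof_orthogonal (phi : R * R -> R) (a : 'I_2 -> R * R -> R) (i : 'I_2) :
  (forall j, L2D (a j)) -> zero_trace phi a ->
  Dint (fun z => radial_cof coef coef' i 0 z * a 0 z +
                 radial_cof coef coef' i 1 z * a 1 z) = 0.
Proof.
move=> aL2 za.
pose C := K + 2 * K' * 2.
have ia j : itgd (a j) by exact: (sqitg_itg mD muD).
have [||||_] := @dominated_Rintegral _ (plane R) R (leb2 R) D mD
  (fun n z => radial_cof (c_ n) (c'_ n) i 0 z * a 0 z +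
              radial_cof (c_ n) (c'_ n) i 1 z * a 1 z)
  (fun z => radial_cof coef coef' i 0 z * a 0 z +
            radial_cof coef coef' i 1 z * a 1 z)
  (fun z => C * `|a 0 z| + C * `|a 1 z|).
- move=> n; apply: measurable_funD; apply: measurable_funM;
    try exact: (itg_measurable (ia _));
    apply: mcont; exact: (continuous_radial_cof (dc n) (dc' n)).
- move=> z _; apply: cvgD; apply: cvgM; try exact: cvg_cst;
    exact: cvg_rad_cof.
- by apply: itgD => //; apply: itgZ => //; exact: itg_norm.
- move=> n z Dz; rewrite (le_trans (ler_normD _ _))//.
  by rewrite !normrM lerD// ler_wpM2r// radial_cof_bnd.
rewrite (_ : (fun n => _) = fun=> 0).
  by move=> /(cvg_lim (@Rhausdorff R)) <-; rewrite lim_cst.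
apply/funext => n.
apply: (@solenoidal_orthogonal _ (radial_cof (c_ n) (c'_ n) i)
  (dradial_cof (c'_ n) (c''_ n) i) phi a) => //.
- by move=> j; exact: (continuous_radial_cof (dc n) (dc' n)).
- by move=> j z; exact: is_derive_radial_cof.
- by move=> j; apply: (continuous_dradial_cof (dc' n)); exact: cc''.
- exact: dradial_cof_div.
Qed.

Let c1_ n i := radial_map_classC1 (dc n) (dc' n) i.

Let L2_radial_map i : [/\ L2D (radial_map coef i),
  forall z, D z -> `|radial_map coef i z| <= K &
  (fun n => Dint (fun z => (radial_map (c_ n) i z - radial_map coef i z) ^+ 2))
    @ \oo --> (0 : R)].
Proof.
apply: (@cvg_L2_bounded _ (plane R) R (leb2 R) D mD muD
  (fun n => radial_map (c_ n) i)).
- by move=> n; apply: mcont; exact: (continuous_radial_map (dc n)).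
- by move=> z _; exact: cvg_rad.
- by move=> n z; exact: rad_bnd.
Qed.

Let L2_radial_grad i j : [/\ L2D (radial_grad coef coef' i j),
  forall z, D z -> `|radial_grad coef coef' i j z| <= K + 2 * K' &
  (fun n => Dint (fun z => (radial_grad (c_ n) (c'_ n) i j z -
    radial_grad coef coef' i j z) ^+ 2)) @ \oo --> (0 : R)].
Proof.
apply: (@cvg_L2_bounded _ (plane R) R (leb2 R) D mD muD
  (fun n => radial_grad (c_ n) (c'_ n) i j)).
- by move=> n; apply: mcont; exact: (continuous_radial_grad (dc n) (dc' n)).
- by move=> z _; exact: cvg_radial_grad.
- by move=> n z; exact: radial_grad_bnd.
Qed.

Lemma radial_map_L2 i : L2D (radial_map coef i).
Proof. by have [] := L2_radial_map i. Qed.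

Lemma radial_grad_L2 i j : L2D (radial_grad coef coef' i j).
Proof. by have [] := L2_radial_grad i j. Qed.

(** These approximations yield both the weak gradient of a radial map and, when
    [coef 1 = 1], its trace, the identity. *)
Lemma radial_approximation : exists f : nat -> 'I_2 -> R * R -> R,
 [/\ forall n i, classC 1 (f n i),
     forall i, (fun n => Dint (fun z => (f n i z - radial_map coef i z) ^+ 2))
       @ \oo --> (0 : R),
     forall i j, (fun n => Dint (fun z => (partial j (f n i) z -
       radial_grad coef coef' i j z) ^+ 2)) @ \oo --> (0 : R) &
     coef 1 = 1 -> forall i, (fun n => Cint (fun t =>
       (f n i (cos t, sin t) - cpt (cos t, sin t) i) ^+ 2)) @ \oo --> (0 : R)].
Proof.
exists (fun n => radial_map (c_ n)); split.
- by move=> n i; have [] := c1_ n i.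
- by move=> i; have [] := L2_radial_map i.
- move=> i j; under eq_fun => n do rewrite (c1_ n i).2.
  by have [] := L2_radial_grad i j.
- move=> k1 i.
  have sqn1 (t : R) : sqn (cos t, sin t) = 1 by rewrite /sqn/= cos2Dsin2.
  have mI : measurable (`[0, 2 * pi] : set (measurableTypeR R)).
    exact: measurable_itv.
  have [|||_ _] := @cvg_L2_bounded _ _ R mu `[0, 2 * pi] mI (@circle_length R)
    (fun n t => radial_map (c_ n) i (cos t, sin t))
    (fun t => cpt (cos t, sin t) i) K.
  + move=> n; apply: measurable_funTS; apply: continuous_measurable_fun.
    by apply: continuous_circle; exact: (continuous_radial_map (dc n)).
  + move=> t _; rewrite -[X in _ --> X]mul1r -k1 -(sqn1 t).
    exact: cvg_rad.
  + move=> n t _; rewrite /radial_map -[leRHS]mulr1; apply: le_normM => //.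
    by move: i; apply: ord2P; [exact: cos_max|exact: sin_max].
  by [].
Qed.

End radial_limit.

(** * Weak derivatives and traces as limits *)

Section weak.
Context {R : realType}.

Let mD := @measurable_disc1 R.
Let muD := @disc1_finite R.

Lemma L2P (f : R * R -> R) : L2 D f <-> L2D f.
Proof. by split => -[]. Qed.

Lemma test_function_circle (phi : R * R -> R) (t : R) :
  test_function D phi -> phi (cos t, sin t) = 0.
Proof.
move=> [_ _ sub]; apply/eqP; apply: contrapT => /negP p0.
have : D (cos t, sin t) by apply: sub; exact: subset_closure.
by rewrite disc1E /sqn/= cos2Dsin2 ltxx.
Qed.

(** The product of [f k] and a test function vanishes on the unit circle, so the
    boundary term in [green_Rintegral] is zero; both sides then pass to the
    limit. *)
Lemma weak_partial_limit (f : nat -> R * R -> R) (g h : R * R -> R) (j : 'I_2) :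
  (forall k, classC 1 (f k)) -> L2D g -> L2D h ->
  (fun k => Dint (fun z => (f k z - g z) ^+ 2)) @ \oo --> (0 : R) ->
  (fun k => Dint (fun z => (partial j (f k) z - h z) ^+ 2)) @ \oo --> (0 : R) ->
  weak_partial D j g h.
Proof.
move=> f1 L2g L2h fg dfh phi tphi.
have p1 : classC 1 phi by have [/(_ 1%N)] := tphi.
have [cp dp cdp] := classC1P j p1.
have L2p := L2D_continuous cp.
have L2dp := L2D_continuous cdp.
have i1 : itgd (fun z => g z * partial j phi z) by exact: (sqitg_mul mD).
have i2 : itgd (fun z => h z * phi z) by exact: (sqitg_mul mD).
rewrite -(EFin_Rintegral mD i1) -(EFin_Rintegral mD i2) -EFinN; congr EFin.
apply/eqP; rewrite -subr_eq0 opprK -normr_le0.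
have [M1 M10 M1p] := continuous_bounded_disc cp.
have [M2 M20 M2p] := continuous_bounded_disc cdp.
have cf k : continuous (f k) by have [] := f1 k.
have cdf k : continuous (partial j (f k)) by have [] := classC1P j (f1 k).
pose A k z := f k z - g z.
pose B k z := partial j (f k) z - h z.
have L2A k : L2D (A k) by apply: (sqitgB mD) => //; exact: L2D_continuous.
have L2B k : L2D (B k) by apply: (sqitgB mD) => //; exact: L2D_continuous.
have iA k : itgd (A k) by exact: (sqitg_itg mD muD).
have iB k : itgd (B k) by exact: (sqitg_itg mD muD).
have A0 : (fun k => Dint (fun z => `|A k z|)) @ \oo --> (0 : R).
  exact: (cvg_L1_of_L2 mD muD L2A).
have B0 : (fun k => Dint (fun z => `|B k z|)) @ \oo --> (0 : R).
  exact: (cvg_L1_of_L2 mD muD L2B).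
have green k : Dint (fun z => f k z * partial j phi z + phi z * partial j (f k) z) = 0.
  have [_ df _] := classC1P j (f1 k).
  have cF : continuous (fun z => f k z * phi z).
    by move=> z; apply: cvgM; [exact: cf|exact: cp].
  have dF z : is_derive z (basis_vec R j) (fun z => f k z * phi z)
      (f k z * partial j phi z + phi z * partial j (f k) z).
    exact: (is_deriveM (df z) (dp z)).
  have cdF : continuous
      (fun z => f k z * partial j phi z + phi z * partial j (f k) z).
    move=> z; apply: cvgD; apply: cvgM;
      [exact: cf|exact: cdp|exact: cp|exact: cdf].
  apply/eqP; rewrite -normr_le0; apply: (le_trans (green_Rintegral cF dF cdF)).
  have -> : Cint (fun t => `|f k (cos t, sin t) * phi (cos t, sin t)|) = 0.
    rewrite /Rintegral integral0_eq// => t _.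
    by rewrite (test_function_circle t tphi) mulr0 normr0.
  by rewrite mulr0.
have bound k : `|Dint (fun z => g z * partial j phi z) +
    Dint (fun z => h z * phi z)| <=
    M2 * Dint (fun z => `|A k z|) + M1 * Dint (fun z => `|B k z|).
  rewrite -(RintegralD mD i1 i2).
  have iAp : itgd (fun z => A k z * partial j phi z) by exact: (sqitg_mul mD).
  have iBp : itgd (fun z => B k z * phi z) by exact: (sqitg_mul mD).
  have -> : Dint (fun z => g z * partial j phi z + h z * phi z) =
      - (Dint (fun z => A k z * partial j phi z) + Dint (fun z => B k z * phi z)).
    rewrite -(RintegralD mD iAp iBp) -[RHS]add0r -(green k) -RintegralB//.
    + by apply: eq_Rintegral => z _; rewrite /A /B; ring.
    + by apply: (itgD mD); apply: (sqitg_mul mD) => //; exact: L2D_continuous.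
    + exact: itgD.
  rewrite normrN (le_trans (ler_normD _ _))//.
  rewrite -!RintegralZl//; [|exact: itg_norm..].
  apply: lerD.
    apply: (le_trans (le_normr_Rintegral mD iAp)).
    apply: le_Rintegral => //; [exact: itg_norm|by apply: itgZ => //; exact: itg_norm|].
    by move=> z Dz; rewrite normrM mulrC ler_wpM2r// M2p.
  apply: (le_trans (le_normr_Rintegral mD iBp)).
  apply: le_Rintegral => //; [exact: itg_norm|by apply: itgZ => //; exact: itg_norm|].
  by move=> z Dz; rewrite normrM mulrC ler_wpM2r// M1p.
apply: (cvg0_le bound).
by apply: cvg0_add; apply: cvg0_scale.
Qed.

End weak.

Section traces.
Context {R : realType}.

Let mD := @measurable_disc1 R.
Let muD := @disc1_finite R.

(** [has_trace v id] in components and with real-valued integrals. *)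
Definition trace_seq (v : 'I_2 -> R * R -> R) (dv : 'I_2 -> 'I_2 -> R * R -> R)
    (f : nat -> 'I_2 -> R * R -> R) :=
 [/\ forall k i, classC 1 (f k i),
     forall i, (fun k => Dint (fun z => (f k i z - v i z) ^+ 2))
       @ \oo --> (0 : R),
     forall i j, (fun k => Dint (fun z => (partial j (f k i) z - dv i j z) ^+ 2))
       @ \oo --> (0 : R) &
     forall i, (fun k => Cint (fun t =>
       (f k i (cos t, sin t) - cpt (cos t, sin t) i) ^+ 2)) @ \oo --> (0 : R)].

Lemma enorm_sq (z : R * R) : enorm z ^+ 2 = cpt z 0 ^+ 2 + cpt z 1 ^+ 2.
Proof. by rewrite sqr_sqrtr// addr_ge0 ?sqr_ge0. Qed.

Lemma frobenius_sq (A : 'M[R]_2) : frobenius A ^+ 2 =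
  (A 0 0 ^+ 2 + A 0 1 ^+ 2) + (A 1 0 ^+ 2 + A 1 1 ^+ 2).
Proof.
rewrite sqr_sqrtr; last by do 2 apply: sumr_ge0 => ? _; exact: sqr_ge0.
by rewrite !big_ord_recl !big_ord0 !addr0 (_ : lift ord0 ord0 = 1)//; exact: val_inj.
Qed.

Lemma cptB (x y : R * R) i : cpt (x - y) i = cpt x i - cpt y i.
Proof. by move: i; apply: ord2P. Qed.

Lemma cvg0_real (u_ : nat -> \bar R) (r : nat -> R) :
  (forall k, 0 <= r k) -> (forall k, ((r k)%:E <= u_ k)%E) ->
  u_ @ \oo --> 0%E -> r @ \oo --> (0 : R).
Proof.
move=> r0 ru u0; suff : (EFin \o r) @ \oo --> 0%E by move/fine_cvg.
apply: (@squeeze_cvge _ _ _ _ (fun=> 0%E) _ u_) => //; last exact: cvg_cst.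
by apply: nearW => k; rewrite lee_fin r0 ru.
Qed.

Section components.
Variables (v : H1 (disc (1 : R))) (F : R * R -> R * R).
Hypothesis F1 : forall i, classC 1 (fun x => cpt (F x) i).

Let ev i z := cpt (F z) i - cpt (v z) i.
Let eg i j z := partial j (fun x => cpt (F x) i) z - grad v z i j.
Let ec i (t : R) := cpt (F (cos t, sin t)) i - cpt (cos t, sin t) i.

Let L2ev i : L2D (ev i).
Proof.
apply: (sqitgB mD); last exact/L2P/fn_L2.
by apply: L2D_continuous; have [] := F1 i.
Qed.

Let L2eg i j : L2D (eg i j).
Proof.
apply: (sqitgB mD); last exact/L2P/grad_L2.
by apply: L2D_continuous; have [] := classC1P j (F1 i).
Qed.

Let mI : measurable (`[0, 2 * pi] : set (measurableTypeR R)).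
Proof. exact: measurable_itv. Qed.

Let itgec i : mu.-integrable `[0, 2 * pi] (EFin \o (fun t => ec i t ^+ 2)).
Proof.
have cF : continuous (fun x => cpt (F x) i) by have [] := F1 i.
have ce : continuous (ec i).
  by move=> t; apply: cvgB; [exact: (continuous_circle cF)|
    exact: (continuous_circle (@continuous_cpt R i))].
apply: circle_itg => t; apply: (@continuous_compR R (fun x => x ^+ 2)) => //.
exact: exprn_continuous.
Qed.

Lemma integral_enorm_sq :
  (\int[leb2 R]_(x in disc 1) (enorm (F x - v x) ^+ 2)%:E)%E =
  (Dint (fun z => ev 0 z ^+ 2) + Dint (fun z => ev 1 z ^+ 2))%:E.
Proof.
have i0 := (L2ev 0).2; have i1 := (L2ev 1).2.
rewrite -(RintegralD mD i0 i1) (EFin_Rintegral mD (itgD mD i0 i1)).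
by apply: eq_integral => z _; rewrite enorm_sq !cptB.
Qed.

Lemma integral_frobenius_sq :
  (\int[leb2 R]_(x in disc 1) (frobenius (jac F x - grad v x) ^+ 2)%:E)%E =
  ((Dint (fun z => eg 0 0 z ^+ 2) + Dint (fun z => eg 0 1 z ^+ 2)) +
   (Dint (fun z => eg 1 0 z ^+ 2) + Dint (fun z => eg 1 1 z ^+ 2)))%:E.
Proof.
have i0 := (L2eg 0 0).2; have i1 := (L2eg 0 1).2.
have i2 := (L2eg 1 0).2; have i3 := (L2eg 1 1).2.
have i01 := itgD mD i0 i1; have i23 := itgD mD i2 i3.
rewrite -(RintegralD mD i0 i1) -(RintegralD mD i2 i3) -(RintegralD mD i01 i23).
rewrite (EFin_Rintegral mD (itgD mD i01 i23)).
by apply: eq_integral => z _; rewrite frobenius_sq !mxE.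
Qed.

Lemma integral_circle_sq :
  (\int[mu]_(t in `[0%R, (2 * pi)%R])
    (enorm (F (cos t, sin t) - id (cos t, sin t)) ^+ 2)%:E)%E =
  (Cint (fun t => ec 0 t ^+ 2) + Cint (fun t => ec 1 t ^+ 2))%:E.
Proof.
have i0 := itgec 0; have i1 := itgec 1.
rewrite -(RintegralD mI i0 i1) (EFin_Rintegral mI (itgD mI i0 i1)).
by apply: eq_integral => z _; rewrite enorm_sq !cptB.
Qed.

End components.

Let Rsq_ge0 d (T : measurableType d) (m : {measure set T -> \bar R}) (A : set T)
  (f : T -> R) : 0 <= \int[m]_(x in A) (f x ^+ 2).
Proof. by apply: Rintegral_ge0 => x _; exact: sqr_ge0. Qed.

Lemma has_trace_seq (v : H1 (disc (1 : R))) : has_trace v id ->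
  exists f, trace_seq (fun i z => cpt (v z) i) (fun i j z => grad v z i j) f.
Proof.
move=> [F [F1 Fv FG Fc]].
exists (fun k i z => cpt (F k z) i); split => //.
- move=> i; apply: (cvg0_real _ _ Fv) => k; first exact: Rsq_ge0.
  rewrite integral_enorm_sq// lee_fin.
  by move: i; apply: ord2P; [rewrite lerDl|rewrite lerDr]; exact: Rsq_ge0.
- move=> i j; apply: (cvg0_real _ _ FG) => k; first exact: Rsq_ge0.
  rewrite integral_frobenius_sq// lee_fin.
  move: i j; apply: ord2P; apply: ord2P.
  + by rewrite -addrA lerDl !addr_ge0.
  + by rewrite addrAC lerDr !addr_ge0.
  + by rewrite addrCA lerDl !addr_ge0.
  + by rewrite addrA lerDr !addr_ge0.
- move=> i; apply: (cvg0_real _ _ Fc) => k; first exact: Rsq_ge0.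
  rewrite integral_circle_sq// lee_fin.
  by move: i; apply: ord2P; [rewrite lerDl|rewrite lerDr]; exact: Rsq_ge0.
Qed.

Lemma seq_has_trace (v : H1 (disc (1 : R))) f :
  trace_seq (fun i z => cpt (v z) i) (fun i j z => grad v z i j) f ->
  has_trace v id.
Proof.
move=> [f1 fv fg fc].
exists (fun k z => (f k 0 z, f k 1 z)).
have E k : forall i, (fun z => cpt (f k 0 z, f k 1 z) i) = f k i by exact: ord2P.
have F1 k i : classC 1 (fun z => cpt (f k 0 z, f k 1 z) i) by rewrite E.
split => //.
- under eq_fun => k do rewrite (integral_enorm_sq v (F1 k)).
  by apply: cvg_EFin; [exact: nearW|apply: cvg0_add; exact: fv].
- under eq_fun => k do rewrite (integral_frobenius_sq v (F1 k)).
  apply: cvg_EFin; first exact: nearW.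
  under eq_fun => k do rewrite !E.
  by apply: cvg0_add; apply: cvg0_add; exact: fg.
- under eq_fun => k do rewrite (integral_circle_sq (F1 k)).
  by apply: cvg_EFin; [exact: nearW|apply: cvg0_add; exact: fc].
Qed.

Lemma zero_trace_sub (v w : H1 (disc (1 : R))) i : has_trace v id -> has_trace w id ->
  zero_trace (fun z => cpt (w z) i - cpt (v z) i)
    (fun j z => grad w z i j - grad v z i j).
Proof.
move=> /has_trace_seq[f [f1 fv fg fc]] /has_trace_seq[h [h1 hv hg hc]].
have C1 k : classC 1 (fun z => h k i z - f k i z) /\ forall j,
    partial j (fun z => h k i z - f k i z) =
    (fun z => partial j (h k i) z - partial j (f k i) z).
  apply: classC1_intro.
  + move=> j z; have [_ dh _] := classC1P j (h1 k i).
    have [_ df _] := classC1P j (f1 k i).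
    exact: (is_deriveB (dh z) (df z)).
  + have [ch _] := h1 k i; have [cf _] := f1 k i.
    by move=> z; apply: cvgB; [exact: ch|exact: cf].
  + move=> j z; have [_ _ ch] := classC1P j (h1 k i).
    have [_ _ cf] := classC1P j (f1 k i).
    by apply: cvgB; [exact: ch|exact: cf].
have L2h k : L2D (h k i) by apply: L2D_continuous; have [] := h1 k i.
have L2f k : L2D (f k i) by apply: L2D_continuous; have [] := f1 k i.
have L2dh k j : L2D (partial j (h k i)).
  by have [_ _ c] := classC1P j (h1 k i); exact: L2D_continuous.
have L2df k j : L2D (partial j (f k i)).
  by have [_ _ c] := classC1P j (f1 k i); exact: L2D_continuous.
have L2w : L2D (fun z => cpt (w z) i) by exact/L2P/fn_L2.
have L2v : L2D (fun z => cpt (v z) i) by exact/L2P/fn_L2.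
have L2gw j : L2D (fun z => grad w z i j) by exact/L2P/grad_L2.
have L2gv j : L2D (fun z => grad v z i j) by exact/L2P/grad_L2.
exists (fun k z => h k i z - f k i z); split.
- by move=> k; have [] := C1 k.
- apply: cvg0_squeeze (cvg0_add (cvg0_scale 2 (hv i)) (cvg0_scale 2 (fv i))) => k.
  have B := Rintegral_sqB mD (sqitgB mD (L2h k) L2w) (sqitgB mD (L2f k) L2v).
  rewrite (@eq_Rintegral _ _ _ (leb2 R) D (fun z =>
    (h k i z - f k i z - (cpt (w z) i - cpt (v z) i)) ^+ 2)) in B; first exact: B.
  by move=> z _; congr (_ ^+ 2); ring.
- move=> j; apply: cvg0_squeeze
    (cvg0_add (cvg0_scale 2 (hg i j)) (cvg0_scale 2 (fg i j))) => k.
  have B := Rintegral_sqB mD (sqitgB mD (L2dh k j) (L2gw j))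
    (sqitgB mD (L2df k j) (L2gv j)).
  rewrite (@eq_Rintegral _ _ _ (leb2 R) D (fun z =>
    (partial j (h k i) z - partial j (f k i) z -
     (grad w z i j - grad v z i j)) ^+ 2)) in B; first by rewrite (C1 k).2.
  by move=> z _; congr (_ ^+ 2); ring.
- apply: cvg0_squeeze (cvg0_add (cvg0_scale 2 (hc i)) (cvg0_scale 2 (fc i))) => k.
  have mI : measurable (`[0, 2 * pi] : set (measurableTypeR R)).
    exact: measurable_itv.
  have sqc (g : R * R -> R) : continuous g ->
      sqitg mu `[0, 2 * pi] (fun t => g (cos t, sin t)).
    move=> cg; split.
      apply: measurable_funTS; apply: continuous_measurable_fun.
      exact: continuous_circle.
    apply: circle_itg => t; apply: (@continuous_compR R (fun x => x ^+ 2)).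
      exact: exprn_continuous.
    exact: continuous_circle.
  have ch : continuous (h k i) by have [] := h1 k i.
  have cf : continuous (f k i) by have [] := f1 k i.
  have cc := sqc _ (@continuous_cpt R i).
  have B := Rintegral_sqB mI (sqitgB mI (sqc _ ch) cc) (sqitgB mI (sqc _ cf) cc).
  rewrite (@eq_Rintegral _ _ _ mu `[0, 2 * pi] (fun t =>
    (h k i (cos t, sin t) - f k i (cos t, sin t)) ^+ 2)) in B; first exact: B.
  by move=> t _; congr (_ ^+ 2); ring.
Qed.

End traces.

(** * Comparison of energies *)

(** The determinant constraint replaces [cof G : A] by [- det A], and
    [|A|^2 + 2 det A] and [|A|^2 - 2 det A] are sums of two squares. *)
Lemma polyconvex_bound (R : realType) (A G : 'I_2 -> 'I_2 -> R) (sg tau : R) :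
  `|sg| <= tau ->
  (G 0 0 + A 0 0) * (G 1 1 + A 1 1) - (G 0 1 + A 0 1) * (G 1 0 + A 1 0) =
    G 0 0 * G 1 1 - G 0 1 * G 1 0 ->
  0 <= ((G 0 0 + A 0 0) ^+ 2 + (G 0 1 + A 0 1) ^+ 2 +
       ((G 1 0 + A 1 0) ^+ 2 + (G 1 1 + A 1 1) ^+ 2)) -
    ((G 0 0 ^+ 2 + G 0 1 ^+ 2 + (G 1 0 ^+ 2 + G 1 1 ^+ 2)) +
    (1 - tau) * (A 0 0 ^+ 2 + A 0 1 ^+ 2 + (A 1 0 ^+ 2 + A 1 1 ^+ 2)) +
    2 * (((G 0 0 + sg * G 1 1) * A 0 0 + (G 0 1 - sg * G 1 0) * A 0 1) +
         ((G 1 0 - sg * G 0 1) * A 1 0 + (G 1 1 + sg * G 0 0) * A 1 1))).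
Proof.
move: (A 0 0) (A 0 1) (A 1 0) (A 1 1) (G 0 0) (G 0 1) (G 1 0) (G 1 1).
move=> a b c d x y z t; rewrite ler_norml => /andP[s1 s2] e.
set X := (X in 0 <= X).
have -> : X = (tau + sg) / 2 * ((a + d) ^+ 2 + (b - c) ^+ 2) +
    (tau - sg) / 2 * ((a - d) ^+ 2 + (b + c) ^+ 2) +
    2 * sg * ((x * t - y * z) - ((x + a) * (t + d) - (y + b) * (z + c))).
  by rewrite /X; field.
rewrite e subrr mulr0 addr0.
by rewrite addr_ge0// mulr_ge0 ?addr_ge0 ?sqr_ge0// divr_ge0//; lra.
Qed.

Section minimizer.
Context {R : realType}.

Let mD := @measurable_disc1 R.
Let muD := @disc1_finite R.

Variables (rho M : R).
Hypotheses (hrho0 : 0 < rho) (hrho1 : rho < 1) (hM : `|M| < 4).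

Local Notation xiM := (xi rho M).
Local Notation zetaM := (zeta rho M).

Lemma den_gt0 : 0 < 4 + M - M * rho ^+ 2.
Proof.
move: hM; rewrite ltr_norml => /andP[M1 M2].
have r1 : 0 < 1 - rho ^+ 2 by rewrite subr_gt0 expr_lt1// ltW.
have r2 : 0 < rho ^+ 2 by rewrite exprn_gt0.
have : 0 < (4 + M) * (1 - rho ^+ 2) by rewrite mulr_gt0//; lra.
by nra.
Qed.

Let rho_neq0 : rho != 0. Proof. by rewrite gt_eqF. Qed.

Lemma zeta_xi : zetaM = xiM + (1 - xiM) / rho ^+ 2.
Proof.
have := den_gt0; rewrite /zeta /xi => d0; field.
by rewrite rho_neq0 gt_eqF.
Qed.

Definition coefU := coef rho xiM (1 - xiM).
Definition coefU' := coef' rho (1 - xiM).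
Definition gradU (i j : 'I_2) := radial_grad coefU coefU' i j.

(** The coefficient of the radial map whose cofactor matrix is the calibrating
    tensor; see [stressE] for the origin of the constants. *)
Definition coefT := coef rho (xiM * (1 - M / 4)) (- ((1 - xiM) * (1 + M / 4))).
Definition coefT' := coef' rho (- ((1 - xiM) * (1 + M / 4))).
Definition stress (i j : 'I_2) := radial_cof coefT coefT' i j.

Lemma enorm_lt (z : R * R) : (enorm z < rho) = (sqn z < rho ^+ 2).
Proof. by apply/idP/idP => /(discE z hrho0). Qed.

Lemma cpt_u i z : cpt (u rho M z) i = radial_map coefU i z.
Proof.
have E : (if enorm z < rho then zetaM else xiM + (1 - xiM) / enorm z ^+ 2) =
    coefU (sqn z).
  rewrite enorm_lt /coefU /coef /profile; case: ifPn => _; first exact: zeta_xi.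
  by rewrite enorm_sq /sqn.
by rewrite /u E /radial_map; move: i; apply: ord2P.
Qed.

Lemma coefU1 : coefU 1 = 1.
Proof.
rewrite /coefU /coef /profile ltNge expr_le1 ?(ltW hrho1) ?(ltW hrho0)//=.
by rewrite invr1 mulr1 addrC subrK.
Qed.

Lemma det_gradU z : gradU 0 0 z * gradU 1 1 z - gradU 0 1 z * gradU 1 0 z =
  g rho M z.
Proof.
rewrite /g enorm_lt /gradU /radial_grad /coefU /coefU' /coef /coef' /profile /profile'.
case: ifPn => [_|]; first by rewrite zeta_xi /=; ring.
rewrite -leNgt => h.
have s0 : sqn z != 0 by rewrite gt_eqF// (lt_le_trans _ h)// exprn_gt0.
rewrite (_ : enorm z ^- 4 = sqn z ^- 2); last first.
  by rewrite -[4%N]/(2 * 2)%N exprM enorm_sq.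
have sE : cpt z 0 * cpt z 0 + cpt z 1 * cpt z 1 = sqn z by rewrite /sqn !expr2.
move: s0 sE; move: (sqn z) (cpt z 0) (cpt z 1) (xiM) {h} => s x y b s0 sE /=.
transitivity ((b + (1 - b) * s^-1) ^+ 2 + 2 * (b + (1 - b) * s^-1) *
  ((1 - b) * - s ^- 2) * (x * x + y * y)); first by ring.
by rewrite sE; field.
Qed.

(** Half the Lagrange multiplier of the determinant constraint: it is constant on
    each side of the circle of radius [rho].  The equations only determine its jump,
    [M/2]; sharing it evenly gives the smallest supremum norm, [|M|/4]. *)
Definition weight (z : R * R) : R := if sqn z < rho ^+ 2 then M / 4 else - (M / 4).

Lemma weight_norm z : `|weight z| <= `|M| / 4.
Proof.
have h : `|M / 4| = `|M| / 4 by rewrite normrM normfV [X in _ / X]ger0_norm.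
by rewrite /weight; case: ifPn => _; rewrite ?normrN h.
Qed.

(** This is where the values of [zeta] and [xi] matter: the coefficient that
    fits outside the circle of radius [rho] extends continuously by the one that is
    needed inside. *)
Lemma coefT_inside : xiM * (1 - M / 4) + - ((1 - xiM) * (1 + M / 4)) * rho ^- 2 =
  zetaM + M / 4 * zetaM.
Proof.
have := den_gt0; rewrite /zeta /xi => d0; field.
by rewrite rho_neq0 gt_eqF.
Qed.

Lemma stressE (z : R * R) :
  [/\ stress 0 0 z = gradU 0 0 z + weight z * gradU 1 1 z,
      stress 0 1 z = gradU 0 1 z - weight z * gradU 1 0 z,
      stress 1 0 z = gradU 1 0 z - weight z * gradU 0 1 z &
      stress 1 1 z = gradU 1 1 z + weight z * gradU 0 0 z].
Proof.
rewrite /stress /gradU /radial_cof /radial_grad /coefT /coefT' /coefU /coefU' /coef /coef'.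
rewrite /weight /profile /profile'.
case: ifPn => [_|].
  rewrite coefT_inside -zeta_xi.
  by split; rewrite /=; ring.
rewrite -leNgt => h.
have s0 : sqn z != 0 by rewrite gt_eqF// (lt_le_trans _ h)// exprn_gt0.
have yy : cpt z 1 * cpt z 1 = sqn z - cpt z 0 * cpt z 0.
  by rewrite /sqn; ring.
move: s0 yy; move: (sqn z) (cpt z 0) (cpt z 1) (xiM) {h} => s x y b s0 yy /=.
by split; rewrite -!mulrA ?yy; field.
Qed.

Let cptU_L2 i : L2 D (fun z => cpt (u rho M z) i).
Proof.
apply/L2P; rewrite (_ : (fun z => _) = radial_map coefU i).
  exact: radial_map_L2.
by apply/funext => z; exact: cpt_u.
Qed.

Let grad_mx (z : R * R) : 'M[R]_2 := \matrix_(i, j) gradU i j z.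

Let gradU_L2 i j : L2 D (fun z => grad_mx z i j).
Proof.
apply/L2P; rewrite (_ : (fun z => _) = gradU i j).
  exact: radial_grad_L2.
by apply/funext => z; rewrite mxE.
Qed.

Let U_weak i j : weak_partial D j (fun z => cpt (u rho M z) i)
  (fun z => grad_mx z i j).
Proof.
rewrite (_ : (fun z => cpt _ i) = radial_map coefU i); last first.
  by apply/funext => z; exact: cpt_u.
rewrite (_ : (fun z => _) = gradU i j); last by apply/funext => z; rewrite mxE.
have [f [f1 fv fg _]] := radial_approximation hrho0 xiM (1 - xiM).
apply: (@weak_partial_limit _ (fun n => f n i)) => //.
- exact: radial_map_L2.
- exact: radial_grad_L2.
Qed.

Definition minimizer : H1 (disc (1 : R)) := MkH1 cptU_L2 gradU_L2 U_weak.

Lemma minimizer_grad z i j : grad minimizer z i j = gradU i j z.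
Proof. by rewrite /= mxE. Qed.

Lemma minimizer_trace : has_trace minimizer id.
Proof.
have [f [f1 fv fg fc]] := radial_approximation hrho0 xiM (1 - xiM).
apply: (@seq_has_trace _ _ f); split => //.
- move=> i; rewrite (_ : (fun n => _) = (fun n => Dint (fun z =>
    (f n i z - radial_map coefU i z) ^+ 2))); first exact: fv.
  by apply/funext => n; apply: eq_Rintegral => z _; rewrite /= cpt_u.
- move=> i j; rewrite (_ : (fun n => _) = (fun n => Dint (fun z =>
    (partial j (f n i) z - gradU i j z) ^+ 2))); first exact: fg.
  by apply/funext => n; apply: eq_Rintegral => z _; rewrite /= mxE.
- exact: fc coefU1.
Qed.

Lemma det2 (A : 'M[R]_2) : \det A = A 0 0 * A 1 1 - A 0 1 * A 1 0.
Proof.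
rewrite (expand_det_row _ 0) !big_ord_recl big_ord0 addr0 /cofactor !det_mx11 !mxE.
have l1 : lift ord0 ord0 = 1 :> 'I_2 by exact: val_inj.
have l0 : lift (1 : 'I_2) ord0 = 0 by exact: val_inj.
by rewrite l1 ?l0 /= ?addn0 ?addn1 ?expr0 ?expr1 ?mul1r ?mulN1r ?mulrN.
Qed.

Lemma minimizer_admissible : admissible (g rho M) minimizer.
Proof.
split; first exact: minimizer_trace.
by apply: aeW => z _; rewrite det2 !minimizer_grad det_gradU.
Qed.

Lemma dirichletE (v : H1 (disc (1 : R))) : dirichlet v =
  (Dint (fun z => grad v z 0 0 ^+ 2 + grad v z 0 1 ^+ 2 +
                  (grad v z 1 0 ^+ 2 + grad v z 1 1 ^+ 2)))%:E.
Proof.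
have i i j : itgd (fun z => grad v z i j ^+ 2) by have [] := grad_L2 v i j.
rewrite (EFin_Rintegral mD); last by do !apply: (itgD mD).
by apply: eq_integral => z _; rewrite frobenius_sq.
Qed.

Section comparison.
Variable w : H1 (disc (1 : R)).
Hypothesis wadm : admissible (g rho M) w.

Let A (i j : 'I_2) z := grad w z i j - grad minimizer z i j.

Let A_L2 i j : L2D (A i j).
Proof. by apply: (sqitgB mD); apply/L2P; exact: grad_L2. Qed.

Let zt i : zero_trace (fun z => cpt (w z) i - cpt (minimizer z) i)
  (fun j z => grad w z i j - grad minimizer z i j).
Proof. by apply: zero_trace_sub; [exact: minimizer_trace|exact: wadm.1]. Qed.

Let stress_orth i : Dint (fun z => stress i 0 z * A i 0 z + stress i 1 z * A i 1 z) = 0.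
Proof. exact: (@radial_cof_orthogonal R rho hrho0 _ _ _ (A i) i (A_L2 i) (zt i)). Qed.

Let W z := grad w z 0 0 ^+ 2 + grad w z 0 1 ^+ 2 +
           (grad w z 1 0 ^+ 2 + grad w z 1 1 ^+ 2).
Let G z := gradU 0 0 z ^+ 2 + gradU 0 1 z ^+ 2 +
           (gradU 1 0 z ^+ 2 + gradU 1 1 z ^+ 2).
Let N z := A 0 0 z ^+ 2 + A 0 1 z ^+ 2 + (A 1 0 z ^+ 2 + A 1 1 z ^+ 2).
Let S i z := stress i 0 z * A i 0 z + stress i 1 z * A i 1 z.

(** [polyconvex_bound], integrated: the term that is linear in [A] vanishes by
    [stress_orth]. *)
Lemma energy_excess :
  (1 - `|M| / 4) * Dint N <= Dint W - Dint G.
Proof.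
have iW : itgd W.
  have i i j : itgd (fun z => grad w z i j ^+ 2) by have [] := grad_L2 w i j.
  by do !apply: (itgD mD).
have iG : itgd G.
  have i i j : itgd (fun z => gradU i j z ^+ 2).
    by have [] := radial_grad_L2 hrho0 xiM (1 - xiM) i j.
  by do !apply: (itgD mD).
have iN : itgd N.
  have i i j : itgd (fun z => A i j z ^+ 2) by have [] := A_L2 i j.
  by do !apply: (itgD mD).
have L2T i j : L2D (stress i j) by exact: radial_cof_L2.
have iS i : itgd (S i) by apply: (itgD mD); exact: (sqitg_mul mD).
have iKN := itgZ mD (1 - `|M| / 4) iN.
have iGN := itgD mD iG iKN.
have iSS := itgD mD (iS 0) (iS 1).
have i2S := itgZ mD 2 iSS.
have iR := itgD mD iGN i2S.
pose q z := W z - (G z + (1 - `|M| / 4) * N z + 2 * (S 0 z + S 1 z)).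
have iq : itgd q by exact: (itgB mD iW iR).
(* q is nonnegative where the determinant constraint holds, hence q = |q|
   almost everywhere *)
have q0 : 0 <= Dint q.
  rewrite /Rintegral fine_ge0//.
  rewrite (@ae_eq_integral _ _ _ (leb2 R) D (fun z => `|(q z)%:E|%E))//.
  - by apply: integral_ge0 => z _; exact: abse_ge0.
  - exact: measurable_int iq.
  - by apply: measurableT_comp => //; exact: measurable_int iq.
  have [_ [Z [mZ Z0 subZ]]] := wadm; exists Z; split => //.
  apply: subset_trans subZ; apply: subsetC => z /= + Dz => /(_ Dz).
  rewrite det2 -det_gradU => e; rewrite /= ger0_norm//.
  have [t00 t01 t10 t11] := stressE z.
  rewrite /q /S t00 t01 t10 t11.
  have WE i j : grad w z i j = gradU i j z + A i j z.
    by rewrite /A minimizer_grad addrC subrK.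
  rewrite !WE in e.
  have := @polyconvex_bound R (fun i j => A i j z) (fun i j => gradU i j z)
    (weight z) (`|M| / 4) (weight_norm z) e.
  by rewrite /W /G /N !WE.
move: q0; rewrite /q RintegralB// (RintegralD mD iGN i2S) (RintegralD mD iG iKN).
rewrite (RintegralZl _ mD iN) (RintegralZl _ mD iSS) (RintegralD mD (iS 0) (iS 1)).
rewrite !stress_orth addr0 mulr0 addr0.
by move: (Dint W) (Dint G) (_ * _) => x y t; lra.
Qed.

Lemma dirichlet_Rintegral : dirichlet w = (Dint W)%:E /\
  dirichlet minimizer = (Dint G)%:E.
Proof.
split; rewrite dirichletE//; congr (_%:E).
by apply: eq_Rintegral => z _; rewrite !minimizer_grad.
Qed.

Lemma modulus_gt0 : 0 < 1 - `|M| / 4.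
Proof. by rewrite subr_gt0 ltr_pdivrMr// mul1r. Qed.

Let N_ge0 z : 0 <= N z.
Proof. by rewrite !addr_ge0 ?sqr_ge0. Qed.

Lemma minimizer_le : (dirichlet minimizer <= dirichlet w)%E.
Proof.
have [-> ->] := dirichlet_Rintegral; rewrite lee_fin -subr_ge0.
apply: le_trans energy_excess; rewrite mulr_ge0 ?(ltW modulus_gt0)//.
exact: Rintegral_ge0.
Qed.

Lemma minimizer_unique : (dirichlet w <= dirichlet minimizer)%E ->
  {ae leb2 R, forall x, D x -> w x = minimizer x}.
Proof.
have [-> ->] := dirichlet_Rintegral; rewrite lee_fin -subr_le0 => /(le_trans energy_excess).
rewrite pmulr_rle0 ?modulus_gt0// => N0.
have iA2 i j : itgd (fun z => A i j z ^+ 2) by have [] := A_L2 i j.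
have iN : itgd N by do !apply: (itgD mD).
have A0 i : Dint (fun z => A i 0 z ^+ 2) = 0.
  apply/eqP; rewrite eq_le; apply/andP; split; last first.
    by apply: Rintegral_ge0 => z _; exact: sqr_ge0.
  apply: le_trans N0; apply: le_Rintegral => // z _; rewrite /N.
  by move: i; apply: ord2P; [rewrite -addrA lerDl|rewrite addrCA lerDl];
    rewrite !addr_ge0 ?sqr_ge0.
pose phi i z := cpt (w z) i - cpt (minimizer z) i.
have phi_L2 i : L2D (phi i).
  by apply: (sqitgB mD); apply/L2P; exact: fn_L2.
have phi0 i : Dint (fun z => phi i z ^+ 2) = 0.
  exact: (zero_trace_poincare (phi_L2 i) (A_L2 i 0) (zt i) (A0 i)).
have ae0 i : ae_eq (leb2 R) D (fun z => (phi i z ^+ 2)%:E) (cst 0%E).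
  apply/(ae_eq_integral_abs _ mD); first exact: measurable_int (phi_L2 i).2.
  under eq_integral => z _ do rewrite gee0_abs ?lee_fin ?sqr_ge0//.
  by rewrite -(EFin_Rintegral mD (phi_L2 i).2) phi0.
have [Z0 [mZ0 mu0 sub0]] := ae0 0; have [Z1 [mZ1 mu1 sub1]] := ae0 1.
exists (Z0 `|` Z1); split.
- exact: measurableU.
- by apply: null_set_setU.
move=> z /= nz; apply: contrapT => /not_orP[n0 n1]; apply: nz => Dz.
have eqi i : phi i z ^+ 2 = 0 -> cpt (w z) i = cpt (minimizer z) i.
  by move/eqP; rewrite sqrf_eq0 subr_eq0 => /eqP.
have e0 : cpt (w z) 0 = cpt (minimizer z) 0.
  apply: eqi; apply: contrapT => h; apply/n0/sub0 => /= /(_ Dz) [].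
  exact: h.
have e1 : cpt (w z) 1 = cpt (minimizer z) 1.
  apply: eqi; apply: contrapT => h; apply/n1/sub1 => /= /(_ Dz) [].
  exact: h.
rewrite [LHS]surjective_pairing [RHS]surjective_pairing.
by rewrite -!cpt0 -!cpt1 e0 e1.
Qed.

End comparison.

End minimizer.

Unset Implicit Arguments.

Theorem mainTheorem2 (R : realType) (rho M : R)
  (hrho0 : 0 < rho) (hrho1 : rho < 1) (hM : `|M| < 4) :
  exists U : H1 (disc (1 : R)),
    (forall x, disc 1 x -> U x = u rho M x) /\
    unique_global_minimizer (admissible (g rho M)) U.
Proof.
exists (minimizer hrho0 hrho1 hM); split => //; split; first split.
- exact: minimizer_admissible.
- by move=> w wadm; exact: minimizer_le.
- move=> w [wadm wmin]; apply: minimizer_unique => //.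
  exact/wmin/minimizer_admissible.
Qed.
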